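(* Let $I=[0,\infty)$ and let $w$ be a weight function on $I$. Let $\varphi$ and $\varphi_n$ ($n\ge1$) be Orlicz functions such that each $\varphi_n$ satisfies the $\Delta_\varphi(0)$-condition. Then the set $(\Lambda_{\varphi,w})_a\setminus\bigcup_{n=1}^\infty\Lambda_{\varphi_n,w}$ is $\mathfrak{c}$-spaceable in $(\Lambda_{\varphi,w})_a$. Moreover, if $\varphi$ satisfies the $\Delta_2$-condition, then $\Lambda_{\varphi,w}\setminus\bigcup_{n=1}^\infty\Lambda_{\varphi_n,w}$ is maximal-spaceable in $\Lambda_{\varphi,w}$.
   Context: The interval $I=[0,\infty)$ carries Lebesgue measure $m$. $L_0$ is the space of real Lebesgue measurable functions on $I$ modulo a.e. equality. For $f\in L_0$, $d_f(\lambda)=m(\{t\in I:|f(t)|>\lambda\})$ for $\lambda>0$, and $f^*(t)=\inf\{\lambda>0:d_f(\lambda)\le t\}$ for $t\ge 0$ (with $\inf\varnothing=\infty$). An Orlicz function is a convex function $\varphi:[0,\infty)\to[0,\infty)$ with $\varphi(0)=0=\lim_{u\to0}\varphi(u)$ and $\varphi(u)>0$ for $u>0$ (put $\varphi(\infty)=\infty$). It satisfies the $\Delta_2^\infty$-condition if there are $K>2$, $u_0\ge0$ with $\varphi(2u)\le K\varphi(u)$ for all $u\ge u_0$; the $\Delta_2^0$-condition if there are $K>2$, $u_0>0$ with $\varphi(2u)\le K\varphi(u)$ for all $0\le u\le u_0$; the $\Delta_2$-condition if it satisfies both. An Orlicz function $\psi$ satisfies the $\Delta_\varphi(0)$-condition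 if for every $b>0$ there exists $u_0>0$ such that $\varphi(u)\le\psi(bu)$ for every $0\le u\le u_0$. A weight function on $I$ is a positive, decreasing (i.e. nonincreasing) function $w:(0,\infty)\to(0,\infty)$ with $\int_0^t w<\infty$ for every $t>0$ and $\int_0^\infty w=\infty$. The modular is $\rho_{\varphi,w}(f)=\int_I\varphi(f^*(t))w(t)\,dt$. The Orlicz-Lorentz space is $\Lambda_{\varphi,w}=\{f\in L_0:\rho_{\varphi,w}(kf)<\infty\text{ for some }k>0\}$ with the Luxemburg norm $\|f\|_{\varphi,w}=\inf\{\varepsilon>0:\rho_{\varphi,w}(f/\varepsilon)\le1\}$ (a Banach space). $(\Lambda_{\varphi,w})_a$ is its closed subspace of order-continuous elements (those $f$ with $\|f_n\|_{\varphi,w}\downarrow0$ whenever $|f_n|\le|f|$ and $|f_n|\downarrow0$ a.e.); it is well known that $(\Lambda_{\varphi,w})_a=\{f\in L_0:\rho_{\varphi,w}(kf)<\infty\text{ for every }k>0\}$. $\mathfrak{c}$ is the cardinality of the continuum; $\dim$ is algebraic dimension. A subset $A$ of a topological vector space $X$ is $\alpha$-spaceable in $X$ ($\alpha$ a cardinal) if there is a closed $\alpha$-dimensional vector subspace $M$ of $X$ with $M\subset A\cup\{0\}$; it is maximal-spaceable if it is $\dim(X)$-spaceable. *)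

(* Defs.v *)
From HB Require Import structures.
From mathcomp Require Import all_boot all_order all_algebra.
From mathcomp Require Import all_classical all_reals all_analysis measurable_realfun.

Set Implicit Arguments.
Unset Strict Implicit.
Unset Printing Implicit Defensive.
Import Order.TTheory GRing.Theory Num.Theory.
Import numFieldNormedType.Exports.

Local Open Scope classical_set_scope.
Local Open Scope ring_scope.

(* R with its Lebesgue (and not only Borel) sigma-algebra. *)
Notation lebesgue_type R := (caratheodory_type ((@wlength R idfun)^*)%mu).

Definition leb (R : realType) : {measure set (lebesgue_type R) -> \bar R} :=
  @completed_lebesgue_measure R.

Definition half_line (R : realType) : set (lebesgue_type R) :=
  (`[0, +oo[%classic : set R).

Lemma measurable_half_line (R : realType) : measurable (@half_line R).
Proof.
by apply: sub_caratheodory; exact: (measurable_itv (`[0%R, +oo[ : interval R)).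
Qed.

(* Functions on I = [0, +oo[ are represented by functions on the whole line, and
   the part of the line outside I is null for this measure. *)
Definition leb_I (R : realType) : {measure set (lebesgue_type R) -> \bar R} :=
  mrestr (leb R) (@measurable_half_line R).

(* Real Lebesgue measurable functions on I modulo equality a.e. on I. *)
Definition L0 (R : realType) : Type :=
  {mfun_ leb_I R, lebesgue_type R >-> R}.
HB.instance Definition _ (R : realType) := Choice.on (L0 R).
HB.instance Definition _ (R : realType) := EqQuotient.on (L0 R).

Section L0_lmodType.
Variable R : realType.
Implicit Types f g h : L0 R.

Local Notation mfunL := {mfun lebesgue_type R >-> R}.
Local Notation ae_eq f g :=
  ((f : lebesgue_type R -> R) = (g : lebesgue_type R -> R) %[ae leb_I R]).

Definition L0_fun f : lebesgue_type R -> R := aqEqMfun_to_fun f.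

Definition L0_class (f : mfunL) : L0 R := (\pi_(L0 R) f)%qT.

Lemma L0_classK (f : mfunL) : ae_eq (L0_fun (L0_class f)) f.
Proof.
rewrite /L0_fun /L0_class /aqEqMfun_to_fun.
have /eqP : (\pi_(L0 R) (repr (\pi_(L0 R) f))
  = \pi_(L0 R) f)%qT by rewrite reprK.
by rewrite eqmodE => /asboolP.
Qed.

Lemma L0_eqP f g : ae_eq (L0_fun f) (L0_fun g) -> f = g.
Proof.
move=> fg; rewrite -[f](@reprK _ (L0 R)).
rewrite -[g](@reprK _ (L0 R)).
by apply/eqP; rewrite eqmodE; exact/asboolP.
Qed.

Let rep f : mfunL := repr f.

Definition L0_zero : L0 R := L0_class 0.
Definition L0_opp f : L0 R := L0_class (- rep f).
Definition L0_add f g : L0 R := L0_class (rep f + rep g).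
Definition L0_scale (a : R) f : L0 R := L0_class (a *: rep f).

Let zeroE : ae_eq (L0_fun L0_zero) (cst 0).
Proof. exact: L0_classK. Qed.
Let oppE f : ae_eq (L0_fun (L0_opp f)) (fun t => - L0_fun f t).
Proof. exact: L0_classK. Qed.
Let addE f g : ae_eq (L0_fun (L0_add f g)) (fun t => L0_fun f t + L0_fun g t).
Proof. exact: L0_classK. Qed.
Let scaleE a f : ae_eq (L0_fun (L0_scale a f)) (fun t => a * L0_fun f t).
Proof. exact: L0_classK. Qed.

Let addA : associative L0_add.
Proof.
move=> f g h; apply: L0_eqP.
apply: filter_app (addE f (L0_add g h)).
move: (addE g h) (addE (L0_add f g) h) (addE f g).
apply: filterS3 => t e2 e3 e4 e1 tT.
by rewrite e1// e2// e3// e4// addrA.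
Qed.
Let addC : commutative L0_add.
Proof.
move=> f g; apply: L0_eqP; move: (addE f g) (addE g f).
by apply: filterS2 => t e1 e2 tT; rewrite e1// e2// addrC.
Qed.
Let add0 : left_id L0_zero L0_add.
Proof.
move=> f; apply: L0_eqP; move: (addE L0_zero f) zeroE.
by apply: filterS2 => t e1 e2 tT; rewrite e1// e2//= add0r.
Qed.
Let addN : left_inverse L0_zero L0_opp L0_add.
Proof.
move=> f; apply: L0_eqP; move: (addE (L0_opp f) f) (oppE f) zeroE.
by apply: filterS3 => t e1 e2 e3 tT; rewrite e1// e2// e3//= addNr.
Qed.
HB.instance Definition _ :=
  GRing.isZmodule.Build (L0 R) addA addC add0 addN.

Let scaleA a b f : L0_scale a (L0_scale b f) = L0_scale (a * b) f.
Proof.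
apply: L0_eqP; move: (scaleE a (L0_scale b f)) (scaleE b f) (scaleE (a * b) f).
by apply: filterS3 => t e1 e2 e3 tT; rewrite e1// e2// e3// mulrA.
Qed.
Let scale1 : left_id 1 L0_scale.
Proof.
move=> f; apply: L0_eqP; move: (scaleE 1 f).
by apply: filterS => t e1 tT; rewrite e1// mul1r.
Qed.
Let scaleDr : right_distributive L0_scale +%R.
Proof.
move=> a f g; apply: L0_eqP.
apply: filter_app (scaleE a (f + g)); apply: filter_app (addE f g).
move: (addE (L0_scale a f) (L0_scale a g)) (scaleE a f) (scaleE a g).
apply: filterS3 => t e3 e4 e5 e2 e1 tT.
by rewrite e1// e2// e3// e4// e5// mulrDr.
Qed.
Let scaleDl f : {morph L0_scale^~ f : a b / a + b}.
Proof.
move=> a b; apply: L0_eqP.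
apply: filter_app (scaleE (a + b) f).
move: (addE (L0_scale a f) (L0_scale b f)) (scaleE a f) (scaleE b f).
apply: filterS3 => t e2 e3 e4 e1 tT.
by rewrite e1// e2// e3// e4// mulrDl.
Qed.
HB.instance Definition _ :=
  GRing.Zmodule_isLmodule.Build R (L0 R) scaleA scale1 scaleDr scaleDl.

Lemma L0_fun0 : ae_eq (L0_fun 0) (cst 0).
Proof. exact: zeroE. Qed.
Lemma L0_funN f : ae_eq (L0_fun (- f)) (fun t => - L0_fun f t).
Proof. exact: oppE. Qed.
Lemma L0_funD f g : ae_eq (L0_fun (f + g)) (fun t => L0_fun f t + L0_fun g t).
Proof. exact: addE. Qed.
Lemma L0_funZ a f : ae_eq (L0_fun (a *: f)) (fun t => a * L0_fun f t).
Proof. exact: scaleE. Qed.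

End L0_lmodType.

Coercion L0_fun : L0 >-> Funclass.

Section orlicz_lorentz.
Variable R : realType.
Implicit Types (f g : L0 R) (phi psi w : R -> R).

Definition orlicz_function phi : Prop :=
  [/\ convex_function (`[0, +oo[%classic : set R^o) phi,
      phi 0 = 0,
      phi u @[u --> 0^'+] --> 0 &
      forall u, 0 < u -> 0 < phi u].

Definition Delta2_infty phi : Prop :=
  exists K u0, [/\ 2 < K, 0 <= u0 &
    forall u, u0 <= u -> phi (2 * u) <= K * phi u].

Definition Delta2_zero phi : Prop :=
  exists K u0, [/\ 2 < K, 0 < u0 &
    forall u, 0 <= u <= u0 -> phi (2 * u) <= K * phi u].

Definition Delta2 phi : Prop := Delta2_infty phi /\ Delta2_zero phi.

(* [Delta_zero phi psi]: psi satisfies the Delta_phi(0)-condition. *)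
Definition Delta_zero phi psi : Prop :=
  forall b, 0 < b -> exists2 u0, 0 < u0 &
    forall u, 0 <= u <= u0 -> phi u <= psi (b * u).

Definition weight_function w : Prop :=
  [/\ forall t, 0 < t -> 0 < w t,
      forall s t, 0 < s -> s <= t -> w t <= w s,
      forall t, 0 < t ->
        (\int[leb R]_(s in (`]0%R, t]%classic : set R)) (w s)%:E < +oo)%E &
      (\int[leb R]_(s in (`]0%R, +oo[%classic : set R)) (w s)%:E = +oo)%E].

Local Open Scope ereal_scope.

Definition distribution_function f (l : R) : \bar R :=
  leb_I R [set t | (l < `|f t|)%R].

Definition rearrangement f (t : R) : \bar R :=
  ereal_inf [set l%:E | l in
    [set l : R | (0 < l)%R /\ distribution_function f l <= t%:E]].

(* [er_map phi] extends phi by phi(+oo) = +oo. The value w 0, on which the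
   definition of a weight says nothing, is used only on the null set {0}. *)
Definition modular phi w f : \bar R :=
  \int[leb R]_(t in @half_line R) (er_map phi (rearrangement f t) * (w t)%:E).

Definition orlicz_lorentz phi w : set (L0 R) :=
  [set f | exists2 k : R, (0 < k)%R & modular phi w (k *: f)%R < +oo].

Definition luxemburg phi w f : \bar R :=
  ereal_inf [set e%:E | e in
    [set e : R | (0 < e)%R /\ modular phi w (e^-1 *: f)%R <= 1]].

Definition order_continuous_part phi w : set (L0 R) :=
  [set f | orlicz_lorentz phi w f /\
    forall g : nat -> L0 R,
      (forall n, {ae leb_I R, forall t, (`|g n t| <= `|f t|)%R}) ->
      {ae leb_I R, forall t,
        nonincreasing_seq (fun n => `|g n t|%R) /\
        (fun n => `|g n t|%R) @ \oo --> (0 : R)%R} ->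
      nonincreasing_seq (fun n => luxemburg phi w (g n)) /\
      (fun n => luxemburg phi w (g n)) @ \oo --> 0].

End orlicz_lorentz.

Section spaceability.
Variables (R : realType) (V : lmodType R).
Implicit Types (A B M X : set V) (N : V -> \bar R).

Definition linear_subspace M : Prop :=
  M 0 /\ forall (a : R) x y, M x -> M y -> M (a *: x + y).

Definition linearly_independent B : Prop :=
  forall (s : seq V) (a : V -> R), uniq s -> (forall x, x \in s -> B x) ->
    \sum_(x <- s) a x *: x = 0 -> forall x, x \in s -> a x = 0.

Definition span B : set V :=
  [set v | exists (s : seq V) (a : V -> R),
    (forall x, x \in s -> B x) /\ v = \sum_(x <- s) a x *: x].

Definition algebraic_basis M B : Prop := linearly_independent B /\ span B = M.

(* Cardinals are represented by sets: the algebraic dimension of M is the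
   cardinality of C. *)
Definition has_dim M (U : Type) (C : set U) : Prop :=
  exists2 B, algebraic_basis M B & (B #= C)%card.

(* X is a linear subspace of V carrying the norm N, whose values outside X do
   not matter; M is closed in X for the topology of this norm. *)
Definition closed_in X N M : Prop :=
  forall x, X x ->
    (forall e : R, 0 < e -> exists2 y, M y & (N (x - y)%R < e%:E)%E) -> M x.

Definition spaceable X N (U : Type) (C : set U) A : Prop :=
  exists M, [/\ linear_subspace M, M `<=` X, closed_in X N M,
    has_dim M C & M `<=` A `|` [set 0]].

Definition maximal_spaceable X N A : Prop :=
  exists2 B, algebraic_basis X B & spaceable X N B A.

(* [set: R] has the cardinality of the continuum. *)
Definition continuum_spaceable X N A : Prop := spaceable X N [set: R] A.

End spaceability.

(* Main.v *)
Require Import Defs.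
From HB Require Import structures.
From mathcomp Require Import all_boot all_order all_algebra.
From mathcomp Require Import all_classical all_reals all_analysis measurable_realfun.
From mathcomp Require Import ring lra.

(** Each [phin n] dominates [phi] near 0 in a strong sense: for all [J] and [K],
    [K * phi (J * u) <= phin n (u / J)] for small [u] ([Delta_zero_dominated]).
    Let [W] be the primitive of the weight, which is unbounded. One can therefore
    choose values [u j] decreasing to 0 and integers [s j], which more than
    double at each step, such that, with [J = j + 1],
    [phi (J * u j) * W (s j) <= 2 ^- J], but [phin n (u j / J) * W (s j / 2) >= J]
    for [1 <= n <= J] ([blocks_exist]).

    Cut the half-line into the blocks [[s (j - 1), s j[] and distribute them into
    infinitely many rows, each with infinitely many blocks. Let [F_i] be equal to
    [u j] on the blocks [j] of row [i], and 0 elsewhere. If [a] is bounded by 1,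
    all multiples of [sum_i a i * F_i] have a finite [phi]-modular
    ([modular_heart_block]). On the other hand, as soon as some [a i] is nonzero,
    all nonzero multiples of this function have an infinite [phin n]-modular,
    because a single block already contributes [J], for arbitrarily large [J]
    ([block_class_notin]).

    Let [M] consist of the functions [sum_i a i * F_i] all of whose multiples have
    a finite [phi]-modular. Such functions are order continuous, by dominated
    convergence ([modular_heart_order_continuous]). Moreover [M] is closed: norm
    convergence implies convergence in measure ([luxemburg_small]), hence a.e.
    convergence of a subsequence, and being proportional to [F_i] on the blocks
    of row [i] is preserved by a.e. limits ([block_class_closed]). That [M] is a
    linear subspace, and that finiteness of the modulars passes to the limit,
    rest on the bound [modularD_le] of the modular of a sum.

    For the dimension, the functions whose coefficients are the powers of a ratio
    in the unit interval form an independent family of the cardinality of the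
    continuum ([geometric_block_independent]), and there are no more than
    continuum many classes of measurable functions ([card_L0_le]). Hence [M], the
    order continuous part and the whole space all have dimension continuum, and
    [M] serves for both halves of the theorem. *)

Set Implicit Arguments.
Unset Strict Implicit.
Unset Printing Implicit Defensive.
Import Order.TTheory GRing.Theory Num.Theory.
Import numFieldNormedType.Exports.

Local Open Scope classical_set_scope.
Local Open Scope ring_scope.

(** * Bases and the cardinality of the continuum *)

Section bases.
Variables (R : realType) (V : lmodType R).
Implicit Types (M B S X : set V).

Lemma linear_subspace_sum M (s : seq V) (a : V -> R) :
  linear_subspace M -> (forall x, x \in s -> M x) -> M (\sum_(x <- s) a x *: x).
Proof.
move=> [M0 Mlin]; elim: s => [|x s IH] Ms; first by rewrite big_nil.
rewrite big_cons; apply: Mlin; first by apply: Ms; rewrite inE eqxx.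
by apply: IH => y ys; apply: Ms; rewrite inE ys orbT.
Qed.

(** In a relation with a nonzero coefficient at [v], the vector [v] could be
    solved for. *)
Lemma linearly_independentU1 B (v : V) :
  linearly_independent B -> ~ Defs.span B v -> linearly_independent (v |` B).
Proof.
move=> indB vB s a us sB s0.
have [vs|vs] := boolP (v \in s); last first.
  apply: (indB s a) => // x xs.
  by have [xv|//] := sB _ xs; move: vs; rewrite -xv xs.
have us' : uniq (rem v s) by rewrite rem_uniq.
have sB' x : x \in rem v s -> B x.
  by rewrite mem_rem_uniq// inE => /andP[/eqP xv /sB[]].
move: s0; rewrite (big_rem v vs)/= => s0.
have av0 : a v = 0.
  apply: contrapT => /eqP av0; apply: vB.
  exists (rem v s), (fun x => - (a v)^-1 * a x); split => //.
  apply: (scalerI av0); rewrite scaler_sumr.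
  under eq_bigr do rewrite scalerA mulrA mulrN mulfV// mulN1r scaleNr.
  by rewrite sumrN; apply/eqP; rewrite -addr_eq0 s0.
move: s0; rewrite av0 scale0r add0r => /(indB _ _ us' sB') a0 x xs.
by have [->//|xv] := eqVneq x v; apply: a0; rewrite mem_rem_uniq// inE xv.
Qed.

(** Finitely many vectors of the union of a chain already lie in one of its
    members, so Zorn's lemma applies to independent sets. *)
Lemma linearly_independent_bigcup S (F : set (set V)) :
  linearly_independent S -> total_on F subset ->
  (forall X, F X -> linearly_independent (S `|` X)) ->
  linearly_independent (S `|` \bigcup_(X in F) X).
Proof.
move=> indS totF indF s a us sF s0.
have [sS|[X FX sX]] : (forall x, x \in s -> S x) \/
    exists2 X, F X & forall x, x \in s -> (S `|` X) x.
  elim: s sF {us s0} => [_|x s IH sF]; first by left.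
  have [sS|[X FX sX]] := IH (fun y ys => sF y (mem_behead (s := x :: s) ys)).
    have [Sx|[X FX Xx]] := sF _ (mem_head _ _).
      by left => y; rewrite inE => /predU1P[->//|/sS].
    right; exists X => // y; rewrite inE => /predU1P[->|/sS]; first by right.
    by left.
  have [Sx|[Y FY Yx]] := sF _ (mem_head _ _); right.
    exists X => // y; rewrite inE => /predU1P[->|/sX//]; by left.
  have [XY|YX] := totF _ _ FX FY; [exists Y => //|exists X => //] => y;
    rewrite inE => /predU1P[->|/sX[Sy|Xy]].
  - by right.
  - by left.
  - by right; exact: XY.
  - by right; exact: YX.
  - by left.
  - by right.
- exact: indS us sS s0.
- exact: indF FX s a us sX s0.
Qed.

(** An independent set that cannot be enlarged inside [M] spans [M]. *)
Lemma algebraic_basis_extend M S : linear_subspace M -> S `<=` M ->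
  linearly_independent S -> exists2 B, algebraic_basis M B & S `<=` B.
Proof.
move=> Mlin SM indS.
pose P X := X `<=` M /\ linearly_independent (S `|` X).
have [F FP totF|A [[AM indA] Amax]] := Zorn_bigcup (P := P).
  split; first by move=> x [X FX Xx]; exact: (FP _ FX).1.
  by apply: linearly_independent_bigcup => // X /FP[].
exists (S `|` A); last exact: subsetUl.
split=> //; apply/seteqP; split=> [v [s [a [sB ->]]]|v Mv].
  by apply: linear_subspace_sum => // x /sB[/SM|/AM].
apply: contrapT => vB; have := linearly_independentU1 indA vB.
rewrite setUCA; apply: contrapT => /contrapT ind.
apply: (Amax (v |` A)); last by split=> // x [->|/AM].
split; first exact: subsetUr.
move=> /(_ v (or_introl erefl)) Av; apply: vB.
exists [:: v], (fun=> 1); split; last by rewrite big_seq1 scale1r.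
by move=> x; rewrite inE => /eqP ->; right.
Qed.

End bases.

(** Evaluating at polynomials turns the vanishing of all the sums of powers
    into the vanishing of all the sums [\sum_t c t * p.[t]]; the polynomial
    whose roots are the other nodes then isolates one coefficient. *)
Lemma power_sums_eq0 (R : fieldType) (s : seq R) (c : R -> R) : uniq s ->
  (forall i : nat, \sum_(t <- s) c t * t ^+ i = 0) ->
  forall t, t \in s -> c t = 0.
Proof.
move=> us cs0 t ts.
have cp0 (p : {poly R}) : \sum_(x <- s) c x * p.[x] = 0.
  under eq_bigr do rewrite horner_coef mulr_sumr.
  rewrite exchange_big/= big1// => i _.
  under eq_bigr do rewrite mulrCA.
  by rewrite -mulr_sumr cs0 mulr0.
pose p := \prod_(x <- rem t s) ('X - x%:P).
have pE x : (p.[x] == 0) = (x \in rem t s).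
  by rewrite -/(root p x) root_prod_XsubC.
have := cp0 p; rewrite (big_rem t ts)/= big_seq big1 => [|x xs]; last first.
  by have /eqP -> : p.[x] == 0; rewrite ?mulr0// pE.
rewrite addr0 => /eqP; rewrite mulf_eq0 => /orP[/eqP//|].
by rewrite pE mem_rem_uniq// inE eqxx.
Qed.

(** Ternary expansions with digits 0 and 1: at the first digit [k] where two of
    them differ, the larger one wins by [3 ^- k], while all later digits
    contribute at most half of that. *)
Lemma card_set_nat_le (R : realType) : ([set: nat -> bool] #<= [set: R])%card.
Proof.
pose p (S : nat -> bool) n : R := \sum_(i < n) (S i)%:R * 3^-1 ^+ i.
have pS S n : p S n.+1 = p S n + (S n)%:R * 3^-1 ^+ n by rewrite /p big_ord_recr.
have q0 n : 0 < (3^-1 : R) ^+ n by rewrite exprn_gt0// invr_gt0.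
have bnd S k n :
    p S (k + n)%N <= p S k + 3/2 * (3^-1 ^+ k - 3^-1 ^+ (k + n)%N).
  elim: n => [|n IH]; first by rewrite addn0 subrr mulr0 addr0.
  rewrite addnS pS exprS; have := q0 (k + n)%N.
  set x := 3^-1 ^+ (k + n)%N in IH *; set y := 3^-1 ^+ k in IH *.
  by case: (S (k + n)%N) => /= ?; rewrite ?mul1r ?mul0r; lra.
have homo S : {homo p S : m n / (m <= n)%N >-> m <= n}.
  apply: homo_leq => // [? ? ?|n]; first exact: le_trans.
  by rewrite pS lerDl mulr_ge0// ltW.
have ub S k n : p S n <= p S k + 3/2 * 3^-1 ^+ k.
  have [nk|/ltnW kn] := leqP n k.
    by apply: (le_trans (homo S _ _ nk)); have := q0 k => ?; lra.
  have := bnd S k (n - k)%N; rewrite subnKC// => h; apply: (le_trans h).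
  by have := q0 n => ?; lra.
pose g S := sup (range (p S)).
have hub S : has_sup (range (p S)).
  split; first by exists (p S 0%N), 0%N.
  by exists (p S 0%N + 3/2 * 3^-1 ^+ 0) => _ [n _ <-].
have gle S k : g S <= p S k + 3/2 * 3^-1 ^+ k.
  by apply: ge_sup => [|_ [n _ <-]//]; have [] := hub S.
have leg S k : p S k <= g S by apply: ub_le_sup; [case: (hub S)|exists k].
have lt k (S T : nat -> bool) : (forall i, (i < k)%N -> S i = T i) -> S k -> ~~ T k -> g T < g S.
  move=> ST Sk Tk; have pST : p S k = p T k.
    by apply: eq_bigr => i _; rewrite ST.
  apply: (le_lt_trans (gle T k.+1)); apply: (lt_le_trans _ (leg S k.+1)).
  rewrite !pS pST Sk (negbTE Tk) exprS /= mul1r mul0r.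
  by have := q0 k; set x := 3^-1 ^+ k => x0; lra.
apply/pcard_injP; exists g => S T _ _ gST; apply/funext => k.
elim/ltn_ind: k => k ST.
have [Sk|Sk] := boolP (S k); have [Tk|Tk] := boolP (T k) => //.
  by have := lt k S T ST Sk Tk; rewrite gST ltxx.
have := lt k T S (fun i ik => esym (ST i ik)) Tk Sk.
by rewrite gST ltxx.
Qed.

Lemma card_countable_bool_le (R : realType) (T : countType) :
  ([set: T -> bool] #<= [set: R])%card.
Proof.
apply: card_le_trans (card_set_nat_le R); apply/pcard_injP.
exists (fun f n => if unpickle n is Some t then f t else false).
move=> f g _ _ /funeqP fg; apply/funext => t.
by have := fg (pickle t); rewrite pickleK.
Qed.

(** The dimension is squeezed between the cardinality of an independent family
    indexed by the reals and that of the whole space. *)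
Lemma continuum_basis (R : realType) (V : lmodType R) (M : set V) (e : R -> V) :
  ([set: V] #<= [set: R])%card -> linear_subspace M -> injective e ->
  range e `<=` M -> linearly_independent (range e) ->
  exists2 B, algebraic_basis M B & (B #= [set: R])%card.
Proof.
move=> VR Mlin einj eM eind.
have [B basB eB] := algebraic_basis_extend Mlin eM eind.
exists B => //; rewrite card_eq_le; apply/andP; split.
  exact: card_le_trans (card_leT B) VR.
apply: card_le_trans (subset_card_le eB).
by have /card_esym/card_eqPle[] := inj_card_eq (A := setT) (in2W einj).
Qed.

(** * Lebesgue measurable functions up to a.e. equality *)

Section lebesgue.
Variable R : realType.
Local Notation lambda := (@lebesgue_measure R).

Lemma borel_lebesgue_measurable (A : set R) :
  measurable (A : set (measurableTypeR R)) -> measurable (A : set (lebesgue_type R)).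
Proof. exact: sub_caratheodory. Qed.

Lemma borel_lebesgue_measurable_fun d (T : measurableType d) (D : set R)
    (f : R -> T) : measurable (D : set (measurableTypeR R)) ->
  measurable_fun (D : set (measurableTypeR R)) f ->
  measurable_fun (D : set (lebesgue_type R)) f.
Proof.
by move=> mD mf _ Y mY; apply: borel_lebesgue_measurable; exact: mf.
Qed.

Lemma measurable_L0_fun (f : L0 R) :
  measurable_fun [set: lebesgue_type R] (f : lebesgue_type R -> R).
Proof. exact: (@measurable_funPT _ _ _ _ (repr f)). Qed.

Lemma measurable_L0_gt (f : L0 R) (q : R) :
  measurable [set t : lebesgue_type R | q < f t].
Proof.
rewrite -[X in measurable X]setTI.
have -> : [set t | q < f t] = (f : _ -> R) @^-1` `]q, +oo[.
  by apply/seteqP; split=> t /=; rewrite in_itv/= andbT.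
exact: measurable_L0_fun.
Qed.

Lemma leb_ae_leb_I (N : set R) (P : R -> Prop) :
  measurable (N : set (lebesgue_type R)) -> leb R N = 0%E ->
  (forall t, ~ P t -> N t) -> {ae leb_I R, forall t, P t}.
Proof.
move=> mN N0 PN; exists N; split=> //.
by apply: (subset_measure0 _ _ _ N0) => //; apply: measurableI => //; exact: measurable_half_line.
Qed.

Lemma ae_half_line : {ae leb_I R, forall t, half_line t}.
Proof.
exists (~` @half_line R); split=> //.
  by apply: measurableC; exact: measurable_half_line.
by rewrite /leb_I/= /mrestr setICl measure0.
Qed.

(** Every point of an open set lies in a rational interval inside the set. *)
Lemma open_subitv_eq (U V : set R) : open U -> open V ->
  (forall p q : rat, `]ratr p, ratr q[ `<=` U <-> `](ratr p : R), ratr q[ `<=` V) ->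
  U = V.
Proof.
suff H : forall U V : set R, open U ->
    (forall p q : rat, `]ratr p, ratr q[ `<=` U -> `](ratr p : R), ratr q[ `<=` V) ->
    U `<=` V.
  by move=> oU oV UV; apply/seteqP; split; apply: H => // p q; apply UV.
move=> {U V}U V oU UV x Ux.
have [r /= r0 rU] := (nbhs_ballP _ _).1 (open_nbhs_nbhs (conj oU Ux)).
have [p /andP[]] := rat_in_itvoo (ltac:(lra) : x - r < x).
rewrite !bnd_simp => rp px.
have [q /andP[]] := rat_in_itvoo (ltac:(lra) : x < x + r).
rewrite !bnd_simp => xq qr.
apply: (UV p q); last by rewrite /= in_itv/= px.
move=> y; rewrite /= in_itv/= => /andP[py yq]; apply: rU.
by rewrite /ball/= ltr_distlC; apply/andP; split; lra.
Qed.

(** A Lebesgue measurable set agrees, up to a null set, with a countable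
    intersection of open sets, and these are described by the rational intervals
    that they contain. Applied to the sets [q < f] cut into pieces of finite
    measure, this encodes [f] up to a.e. equality by countably many bits. *)
Lemma card_L0_le : ([set: L0 R] #<= [set: R])%card.
Proof.
apply: card_le_trans (card_countable_bool_le R (rat * nat * nat * (rat * rat))%type).
pose E (f : L0 R) (q : rat) (n : nat) : set R :=
  [set t | ratr q < f t] `&` `[n%:R, n.+1%:R[.
have mE f q n : measurable (E f q n : set (lebesgue_type R)).
  apply: measurableI; first exact: measurable_L0_gt.
  exact: borel_lebesgue_measurable.
have Efin f q n : (leb R (E f q n) < +oo)%E.
  apply: (@le_lt_trans _ _ (leb R `[n%:R, n.+1%:R[%classic)).
    apply: le_measure; rewrite ?inE//; last exact: subIsetr.
    exact: borel_lebesgue_measurable.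
  rewrite [X in (X < _)%E](lebesgue_measure_itv `[n%:R, n.+1%:R[)/=.
  by case: ifP => _; rewrite ltry.
pose G f q n := projT1 (cid (outer_measure_Gdelta (E f q n))).
have GP f q n : [/\ (forall i, open (G f q n i)),
    E f q n `<=` \bigcap_i G f q n i &
    leb R (\bigcap_i G f q n i) = leb R (E f q n)].
  by rewrite /G; case: cid.
have mG f q n : measurable (\bigcap_i G f q n i : set (lebesgue_type R)).
  apply: borel_lebesgue_measurable; apply: bigcapT_measurable => i.
  by apply: open_measurable; have [] := GP f q n.
have GE0 f q n : leb R (\bigcap_i G f q n i `\` E f q n) = 0%E.
  have [_ EG GE] := GP f q n.
  have Gfin : (leb R (\bigcap_i G f q n i) < +oo)%E by rewrite GE.
  have -> : leb R (\bigcap_i G f q n i `\` E f q n) =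
      (leb R (\bigcap_i G f q n i) - leb R (E f q n))%E.
    by rewrite (measureD (mG f q n) (mE f q n) Gfin) setIidr.
  by rewrite GE subee// ge0_fin_numE.
pose code (f : L0 R) (x : rat * nat * nat * (rat * rat)) : bool :=
  `[< `](ratr x.2.1 : R), ratr x.2.2[%classic `<=` G f x.1.1.1 x.1.1.2 x.1.2 >].
have codeG f g : code f = code g -> forall q n, G f q n = G g q n.
  move=> fg q n; apply/funext => k.
  have [oGf _ _] := GP f q n; have [oGg _ _] := GP g q n.
  apply: open_subitv_eq => // p1 p2.
  have := congr1 (fun h => h (q, n, k, (p1, p2))) fg.
  by rewrite /code/= => e; split=> /asboolP h; apply/asboolP; rewrite ?e// -?e.
apply/pcard_injP; exists code => f g _ _ fg; apply: L0_eqP.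
have aeE h : {ae leb_I R, forall t, forall q n,
    (\bigcap_i G h q n i) t -> E h q n t}.
  have aeq q n : {ae leb_I R, forall t, (\bigcap_i G h q n i) t -> E h q n t}.
    apply: (leb_ae_leb_I (N := \bigcap_i G h q n i `\` E h q n)) => //.
      by apply: measurableD.
    by move=> t /not_implyP[].
  have := ae_foralln (fun k => ae_foralln (aeq (odflt 0 (unpickle k)))).
  by apply: filterS => t tE q n; have := tE (pickle q) n; rewrite pickleK.
move: ae_half_line (aeE f) (aeE g); apply: filterS3 => t tI fE gE _.
have [n /andP[nt tn]] : exists n : nat, n%:R <= t < n.+1%:R.
  by exists (Num.truncn t); apply: truncn_itv; move: tI; rewrite /half_line/= in_itv/= andbT.
have GE q : ratr q < f t <-> ratr q < g t.
  have [_ fG _] := GP f q n; have [_ gG _] := GP g q n.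
  split=> qh.
    have /gE[]// : (\bigcap_i G g q n i) t.
    by rewrite -(codeG _ _ fg); apply: fG; split=> //=; rewrite in_itv/= nt.
  have /fE[]// : (\bigcap_i G f q n i) t.
  by rewrite (codeG _ _ fg); apply: gG; split=> //=; rewrite in_itv/= nt.
apply/eqP; rewrite eq_le; apply/andP; split; rewrite leNgt; apply/negP => /rat_in_itvoo[q];
  rewrite in_itv/= => /andP[h1 h2].
  by have := (GE q).1 h2; rewrite ltNge (ltW h1).
by have := (GE q).2 h2; rewrite ltNge (ltW h1).
Qed.

End lebesgue.

(** * Orlicz functions and Lebesgue integrals *)

Section orlicz_facts.
Variables (R : realType) (phi : R -> R).
Hypothesis phi_orlicz : orlicz_function phi.

Lemma orlicz_ge0 u : 0 <= u -> 0 <= phi u.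
Proof.
case: phi_orlicz => _ p0 _ pp; rewrite le_eqVlt => /predU1P[<-|/pp/ltW//].
by rewrite p0.
Qed.

(** Convexity between [u] and [0], where [phi] vanishes. *)
Lemma orlicz_scale_le a u : 0 <= a <= 1 -> 0 <= u -> phi (a * u) <= a * phi u.
Proof.
case: phi_orlicz => cvx p0 _ _ /andP[a0 a1] u0.
have [t at_] : exists t : {i01 R}, t%:num = a.
  by exists (@Itv01 R a a0 a1).
have /= := cvx t u 0; rewrite !inE /= !in_itv/= lexx u0 => /(_ isT isT).
rewrite p0 /conv/= at_ !scaler0 addr0.
rewrite [X in _ <= X](_ : _ = a * phi u)//.
by rewrite -at_ -[RHS]addr0 -[in RHS](mulr0 (1 - t%:num)).

Qed.

End orlicz_facts.

Section lebesgue_integrals.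
Variable R : realType.
Local Notation lambda := (@lebesgue_measure R).
Local Open Scope ereal_scope.

Let ge0_integral_leb (D : set R) (f : R -> \bar R) :
  measurable (D : set (measurableTypeR R)) ->
  measurable_fun (D : set (measurableTypeR R)) f ->
  (forall x, D x -> 0 <= f x) ->
  \int[leb R]_(x in D) f x = \int[lambda]_(x in D) f x.
Proof.
move=> mD mf f0.
have mid : measurable_fun [set: lebesgue_type R] (idfun : _ -> measurableTypeR R).
  by move=> _ Y mY; rewrite setTI; exact: borel_lebesgue_measurable.
have f0' : {in D, forall y, 0 <= f y} by move=> x; rewrite inE; exact: f0.
transitivity (\int[pushforward (leb R) (idfun : _ -> measurableTypeR R)]_(x in D) f x).
  exact/esym/(ge0_integral_pushforward mid (leb R) mD mf f0').
exact: eq_measure_integral.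
Qed.

(** The restriction of the completed measure to the Borel sets is the Borel
    measure. All integrands below are Borel, being built from monotone
    functions, so they may be integrated against the latter. *)
Lemma integral_leb (D : set R) (f : R -> \bar R) :
  measurable (D : set (measurableTypeR R)) ->
  measurable_fun (D : set (measurableTypeR R)) f ->
  \int[leb R]_(x in D) f x = \int[lambda]_(x in D) f x.
Proof.
move=> mD mf; rewrite integralE [RHS]integralE; congr (_ - _);
  apply: ge0_integral_leb => //.
  exact: measurable_funepos.
exact: measurable_funeneg.
Qed.

Lemma integral_half_line (f : R -> \bar R) :
  measurable_fun (`]0%R, +oo[%classic : set (measurableTypeR R)) f ->
  \int[leb R]_(x in @half_line R) f x = \int[lambda]_(x in `]0%R, +oo[) f x.
Proof.
move=> mf; have mf' := (emeasurable_fun_itv_obnd_cbndP _ _ _).1 mf.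
by rewrite [LHS](integral_leb _ mf')// integral_itv_obnd_cbnd.
Qed.

Lemma nonincreasing_emeasurable (D : set R) (f : R -> \bar R) :
  is_interval D ->
  (forall x y, D x -> D y -> (x <= y)%R -> f y <= f x) ->
  measurable_fun (D : set (measurableTypeR R)) f.
Proof.
move=> iD fD mD; apply: (measurability _ (ErealGenOInfty.measurableE R)) => //.
move=> _ [_ [r ->] <-]; apply: is_interval_measurable => x y [Dx fx] [Dy fy] z xzy.
have Dz : D z by exact: (iD x y).
move: xzy => /andP[_ zy]; split=> //.
move: fx fy; rewrite /= !in_itv/= !andbT => fx fy.
exact: (lt_le_trans fy (fD _ _ Dz Dy zy)).
Qed.

(** Lebesgue measure is doubled when a set is, by uniqueness on intervals. *)
Lemma integral_half_dilation (f : R -> \bar R) :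
  measurable_fun (`]0%R, +oo[%classic : set (measurableTypeR R)) f ->
  (forall x, (0 < x)%R -> 0 <= f x) ->
  \int[lambda]_(x in `]0%R, +oo[) f (x / 2)%R =
  2%:E * \int[lambda]_(x in `]0%R, +oo[) f x.
Proof.
move=> mf f0; pose h (x : R) : measurableTypeR R := (x / 2)%R.
have mh : measurable_fun [set: measurableTypeR R] h.
  exact: mulrr_measurable.
have hK : h @^-1` `]0%R, +oo[ = `]0%R, +oo[%classic.
  by apply/seteqP; split=> x; rewrite /h/= !in_itv/= !andbT; lra.
have f0' : {in `]0%R, +oo[%classic, forall y : R, 0 <= f y}.
  by move=> x; rewrite inE/= in_itv/= andbT; exact: f0.
transitivity (\int[pushforward lambda h]_(x in `]0%R, +oo[) f x).
  by rewrite (ge0_integral_pushforward mh lambda _ mf f0')// hK.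
transitivity (\int[mscale (2%:nng : {nonneg R})%R lambda]_(x in `]0%R, +oo[) f x); last first.
  by rewrite ge0_integral_mscale// => x; rewrite /= in_itv/= andbT; exact: f0.
apply: eq_measure_integral => A mA _.
have h0 : (0 <= 2^-1 :> R)%R by rewrite invr_ge0.
have nuE : lambda A = pushforward (mscale (NngNum h0) lambda) h A.
  apply: lebesgue_measure_unique => //= _ [[a b]] _ <-.
  rewrite /pushforward /mscale.
  have -> : h @^-1` `]a, b]%classic = `](2 * a)%R, (2 * b)%R]%classic.
    by apply/seteqP; split=> x; rewrite /h/= !in_itv/=; lra.
  rewrite !lebesgue_measure_itv/=.
  rewrite (lebesgue_measure_itv `](2 * a)%R, (2 * b)%R])/=.
  rewrite !lte_fin ltr_pM2l//.
  case: ifP => _; last by rewrite mule0.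
  by rewrite -!EFinB -EFinM; congr EFin; field.
transitivity (2%:E * lambda A); last by [].
by rewrite nuE /pushforward /mscale/= muleA -EFinM mulfV// mul1e.
Qed.

End lebesgue_integrals.

Section orlicz_monotone.
Variables (R : realType) (phi : R -> R).
Hypothesis phi_orlicz : orlicz_function phi.

Lemma orlicz_le u v : 0 <= u -> u <= v -> phi u <= phi v.
Proof.
move=> u0 uv; have [v0|v0] := leP v 0.
  by have -> : v = u by lra.
have -> : u = u / v * v by rewrite divfK// gt_eqF.
apply: (le_trans (orlicz_scale_le phi_orlicz _ (ltW v0))).
  by rewrite divr_ge0//= ?ler_pdivrMr ?mul1r// ltW.
rewrite ler_piMl//; first by apply: orlicz_ge0 => //; exact: ltW.
by rewrite ler_pdivrMr// mul1r.
Qed.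

Lemma orlicz_scale_ge a u : 1 <= a -> 0 <= u -> a * phi u <= phi (a * u).
Proof.
move=> a1 u0; have a0 : 0 < a by lra.
rewrite -ler_pdivlMl// -[in leLHS](mulKf (lt0r_neq0 a0) u).
apply: orlicz_scale_le => //; last by rewrite mulr_ge0// ltW.
by rewrite invr_ge0 (ltW a0)/= invf_le1.
Qed.

Lemma orlicz_near0 e : 0 < e -> exists2 d, 0 < d & forall u, 0 <= u <= d -> phi u <= e.
Proof.
move=> e0; have [_ _ p0 _] := phi_orlicz.
have /cvgrPdist_lt/(_ e e0) := p0.
move=> [d /= d0 H]; exists (d / 2); first by rewrite divr_gt0.
move=> u /andP[u0 ud]; apply: (@le_trans _ _ (phi (d/2))); first exact: orlicz_le.
have /H : ball 0 d (d / 2) by rewrite /ball/= sub0r normrN gtr0_norm; lra.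
move=> /(_ ltac:(lra)); rewrite sub0r normrN ger0_norm; first exact: ltW.
by apply: orlicz_ge0 => //; lra.
Qed.

Local Open Scope ereal_scope.

Lemma er_map_orlicz_ge0 x : 0 <= x -> 0 <= er_map phi x.
Proof. by case: x => //= r; rewrite !lee_fin; exact: orlicz_ge0. Qed.

Lemma er_map_orlicz_le x y : 0 <= x -> x <= y -> er_map phi x <= er_map phi y.
Proof.
case: x => [x||]; case: y => [y||]//=; rewrite ?leey ?lee_fin//.
exact: orlicz_le.
Qed.

End orlicz_monotone.

(** * Rearrangements *)

Lemma ae_le_measure d (T : measurableType d) (R : realType)
    (mu : {measure set T -> \bar R}) (A B : set T) :
  measurable A -> measurable B -> {ae mu, forall t, A t -> B t} ->
  (mu A <= mu B)%E.
Proof.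
move=> mA mB [N [mN N0 AB]].
rewrite -(measureU0 mB mN N0).
apply: le_measure; rewrite ?inE//; first exact: measurableU.
move=> t At; have [Bt|Bt] := pselect (B t); [by left|right].
by apply: AB => /= /(_ At).
Qed.

Section rearrangements.
Variable R : realType.
Implicit Types f g h : L0 R.
Local Open Scope ereal_scope.

Lemma measurable_L0_norm_gt f (l : R) :
  measurable [set t : lebesgue_type R | (l < `|f t|)%R].
Proof.
rewrite -[X in measurable X]setTI.
have -> : [set t | (l < `|f t|)%R] = (fun t => `|f t|%R) @^-1` `]l, +oo[.
  by apply/seteqP; split=> t /=; rewrite in_itv/= andbT.
have mf : measurable_fun [set: lebesgue_type R] (fun t => `|f t|%R).
  by apply: measurableT_comp; [exact: normr_measurable|exact: measurable_L0_fun].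
exact: mf.
Qed.

Lemma distribution_function_nonincreasing f (l l' : R) : (l <= l')%R ->
  distribution_function f l' <= distribution_function f l.
Proof.
move=> ll'; apply: le_measure; rewrite ?inE; try exact: measurable_L0_norm_gt.
by move=> t /=; exact: le_lt_trans.
Qed.

Lemma distribution_function_le f g (l : R) :
  {ae leb_I R, forall t, (`|g t| <= `|f t|)%R} ->
  distribution_function g l <= distribution_function f l.
Proof.
move=> gf; apply: ae_le_measure; try exact: measurable_L0_norm_gt.
by apply: filterS gf => t /= gf /lt_le_trans; apply.
Qed.

Lemma distribution_function_max f g h (l : R) :
  {ae leb_I R, forall t, (`|h t| <= Num.max `|f t| `|g t|)%R} ->
  distribution_function h l <=
    distribution_function f l + distribution_function g l.
Proof.
move=> hfg; apply: (le_trans _ (measureU2 _ _ _)); try exact: measurable_L0_norm_gt.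
apply: ae_le_measure; first exact: measurable_L0_norm_gt.
  by apply: measurableU; exact: measurable_L0_norm_gt.
apply: filterS hfg => t /= + lh.
by rewrite le_max => /orP[] /(lt_le_trans lh); [left|right].
Qed.

Lemma rearrangement_ge0 f t : 0 <= rearrangement f t.
Proof. by apply: le_ereal_inf_tmp => _ [l [l0 _] <-]; rewrite lee_fin ltW. Qed.

Lemma rearrangement_le f t (l : R) : (0 < l)%R ->
  distribution_function f l <= t%:E -> rearrangement f t <= l%:E.
Proof. by move=> l0 fl; apply: ereal_inf_lbound; exists l. Qed.

(** Together with [rearrangement_le], this makes the rearrangement the
    generalized inverse of the distribution function. *)
Lemma rearrangement_ge f t (l : R) :
  t%:E < distribution_function f l -> l%:E <= rearrangement f t.
Proof.
move=> fl; apply: le_ereal_inf_tmp => _ [k [k0 fk] <-]; rewrite lee_fin leNgt.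
apply/negP => kl; have := lt_le_trans fl (distribution_function_nonincreasing f (ltW kl)).
by rewrite ltNge fk.
Qed.

Lemma rearrangement_lt f t (l : R) : rearrangement f t < l%:E ->
  (0 < l)%R /\ distribution_function f l <= t%:E.
Proof.
move=> ftl; split.
  by rewrite -lte_fin; exact: le_lt_trans (rearrangement_ge0 f t) ftl.
by rewrite leNgt; apply/negP => /rearrangement_ge; rewrite leNgt ftl.
Qed.

Lemma rearrangement_le_fun f g s t :
  (forall l : R, (0 < l)%R -> distribution_function f l <= t%:E ->
     distribution_function g l <= s%:E) ->
  rearrangement g s <= rearrangement f t.
Proof.
move=> fg; apply: le_ereal_inf_tmp => _ [l [l0 fl] <-].
by apply: rearrangement_le => //; exact: fg.
Qed.

Lemma rearrangement_nonincreasing f s t : (s <= t)%R ->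
  rearrangement f t <= rearrangement f s.
Proof.
by move=> st; apply: rearrangement_le_fun => l l0 /le_trans; apply; rewrite lee_fin.
Qed.

(** If [f] exceeds [l] on a set of measure [t / 2] at most, and so does [g], then
    their maximum does on a set of measure [t] at most. *)
Lemma rearrangement_max f g h t :
  {ae leb_I R, forall t, (`|h t| <= Num.max `|f t| `|g t|)%R} ->
  rearrangement h t <=
    maxe (rearrangement f (t / 2)) (rearrangement g (t / 2)).
Proof.
move=> hfg; set m := maxe _ _.
have m0 : 0 <= m by rewrite le_max rearrangement_ge0.
have [->|] := eqVneq m +oo; first by rewrite leey.
rewrite -ltey => moo; apply/lee_addgt0Pr => e e0.
have mE : m = (fine m)%:E by rewrite fineK// ge0_fin_numE.
have mlt : m < (fine m + e)%:E by rewrite mE lte_fin /= ltrDl.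
rewrite mE -EFinD.
have [l0 fl] : (0 < fine m + e)%R /\ distribution_function f (fine m + e) <= (t / 2)%:E.
  by apply: rearrangement_lt; apply: le_lt_trans mlt; rewrite le_max lexx.
have [_ gl] : (0 < fine m + e)%R /\ distribution_function g (fine m + e) <= (t / 2)%:E.
  by apply: rearrangement_lt; apply: le_lt_trans mlt; rewrite le_max lexx orbT.
apply: rearrangement_le => //; apply: (le_trans (distribution_function_max _ hfg)).
by apply: (le_trans (leeD fl gl)); rewrite -EFinD lee_fin -splitr.
Qed.

End rearrangements.

(** * Weights *)

Section weights.
Variables (R : realType) (w : R -> R).
Hypothesis w_weight : weight_function w.
Local Notation lambda := (@lebesgue_measure R).
Local Open Scope ereal_scope.

Definition weight_primitive (x : R) : \bar R :=
  \int[lambda]_(t in `]0%R, x]) (w t)%:E.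
Local Notation W := weight_primitive.

Lemma weight_gt0 t : (0 < t)%R -> (0 < w t)%R.
Proof. by case: w_weight => + _ _ _; apply. Qed.

Lemma weight_ge0 t : (0 < t)%R -> 0 <= (w t)%:E.
Proof. by move=> t0; rewrite lee_fin ltW// weight_gt0. Qed.

Lemma measurable_weight (D : set R) : D `<=` `]0%R, +oo[ ->
  measurable (D : set (measurableTypeR R)) ->
  measurable_fun (D : set (measurableTypeR R)) (EFin \o w).
Proof.
move=> D0 mD; apply: (measurable_funS _ D0) => //.
apply: nonincreasing_emeasurable; first exact: interval_is_interval.
move=> x y; rewrite /= !in_itv/= !andbT => x0 y0 xy.
by rewrite lee_fin; case: w_weight => _ + _ _; apply.
Qed.

Lemma subset_itv0_pos x : (`]0%R, x] : set R) `<=` `]0%R, +oo[.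
Proof. by move=> t; rewrite /= !in_itv/= => /andP[->]. Qed.

Lemma weight_primitive_lty x : W x < +oo.
Proof.
have [x0|x0] := ltP 0%R x; last first.
  by rewrite /W set_itv_ge ?integral_set0// bnd_simp -leNgt.
case: w_weight => _ _ /(_ _ x0) + _; rewrite integral_leb//.
apply: measurable_weight => //; exact: subset_itv0_pos.
Qed.

Lemma weight_primitive_le x y : (x <= y)%R -> W x <= W y.
Proof.
move=> xy; apply: ge0_subset_integral => //.
- apply: measurable_weight => //; exact: subset_itv0_pos.
- by move=> t; rewrite /= in_itv/= => /andP[t0 _]; exact: weight_ge0.
- by move=> t; rewrite /= !in_itv/= => /andP[->/= /le_trans]; apply.
Qed.

(** On [`]0, x]] the weight is at least [w x]. *)
Lemma weight_primitive_gt0 x : (0 < x)%R -> 0 < W x.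
Proof.
move=> x0; apply: (@lt_le_trans _ _ (\int[lambda]_(t in `]0%R, x]) (w x)%:E)).
  rewrite integral_cst//= lebesgue_measure_itv/= lte_fin x0 oppr0 addr0 -EFinM.
  by rewrite lte_fin mulr_gt0// weight_gt0.
apply: ge0_le_integral => //.
- by move=> t _; exact: weight_ge0.
- apply: measurable_weight => //; exact: subset_itv0_pos.
- move=> t; rewrite /= in_itv/= => /andP[t0 tx]; rewrite lee_fin.
  by case: w_weight => _ + _ _; apply.
Qed.

Lemma weight_primitive_unbounded (A : R) : exists n : nat, A%:E < W n%:R.
Proof.
apply: contrapT => /forallNP H.
pose F (n : nat) : set (measurableTypeR R) := `]0%R, n%:R]%classic.
have nF : nondecreasing_seq F.
  move=> m n mn; apply/subsetPset => t; rewrite /F/= !in_itv/= => /andP[->/=].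
  by move=> /le_trans; apply; rewrite ler_nat.
have mF i : measurable (F i) by exact: measurable_itv.
have mwF i : measurable_fun (F i) (EFin \o w).
  by apply: measurable_weight => //; exact: subset_itv0_pos.
have w0 i x : F i x -> 0 <= (EFin \o w) x.
  by rewrite /F/= in_itv/= => /andP[x0 _]; exact: weight_ge0.
have := @ge0_nondecreasing_set_cvg_integral _ _ _ F _ lambda nF mF mwF w0.
have -> : \bigcup_i F i = `]0%R, +oo[%classic.
  apply/seteqP; split=> [t [n _]|t] /=; rewrite /F/= !in_itv/=.
    by move=> /andP[->].
  rewrite andbT => t0; exists (Num.truncn t).+1 => //.
  by rewrite /= in_itv/= t0/= ltW// truncnS_gt.
have -> : \int[lambda]_(x in `]0%R, +oo[) (EFin \o w) x = +oo.
  case: w_weight => _ _ _ <-; rewrite integral_leb//.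
  exact: measurable_weight.
move=> /cvgeyPgt/(_ A)[n _ /(_ n (leqnn n))]; exact: H.
Qed.

(** Bound [w t] by [w (t / 2)], then substitute [t] for [t / 2]. *)
Lemma weighted_integral_half (K : R -> \bar R) :
  measurable_fun (`]0%R, +oo[%classic : set (measurableTypeR R)) K ->
  (forall t, (0 < t)%R -> 0 <= K t) ->
  \int[lambda]_(t in `]0%R, +oo[) (K (t / 2)%R * (w t)%:E) <=
  2%:E * \int[lambda]_(t in `]0%R, +oo[) (K t * (w t)%:E).
Proof.
move=> mK K0; have mw := measurable_weight (@subset_refl _ _) (measurable_itv `]0%R, +oo[).
have mKw : measurable_fun (`]0%R, +oo[%classic : set (measurableTypeR R))
    (fun t => K t * (w t)%:E) by exact: emeasurable_funM.
have mh : measurable_fun (`]0%R, +oo[%classic : set (measurableTypeR R))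
    (fun t : R => (t / 2)%R : measurableTypeR R) by exact: mulrr_measurable.
have h0 : (fun t : R => t / 2)%R @` `]0%R, +oo[ `<=` `]0%R, +oo[.
  move=> _ [t t0 <-]; move: t0; rewrite /= !in_itv/= !andbT => t0.
  by rewrite divr_gt0.
rewrite -integral_half_dilation//; last first.
  by move=> t t0; rewrite mule_ge0// ?K0// weight_ge0.
have mKh : measurable_fun (`]0%R, +oo[%classic : set (measurableTypeR R))
    (fun t => K (t / 2)%R).
  exact: (measurable_comp (F := `]0%R, +oo[%classic : set (measurableTypeR R))).
have mwh : measurable_fun (`]0%R, +oo[%classic : set (measurableTypeR R))
    (fun t => (w (t / 2)%R)%:E).
  exact: (measurable_comp (F := `]0%R, +oo[%classic : set (measurableTypeR R)) _ h0 mw).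
apply: ge0_le_integral => //.
- move=> t; rewrite /= in_itv/= andbT => t0.
  by rewrite mule_ge0// ?K0 ?divr_gt0// weight_ge0.
- exact: emeasurable_funM.
- exact: emeasurable_funM.
- move=> t; rewrite /= in_itv/= andbT => t0.
  apply: lee_wpmul2l; first by rewrite K0 ?divr_gt0.
  rewrite lee_fin; case: w_weight => _ + _ _; apply; first by rewrite divr_gt0.
  by rewrite ler_pdivrMr// ler_pMr// ler1n.
Qed.

Lemma weight_primitive_double x : W (2 * x)%R <= 2%:E * W x.
Proof.
pose K (t : R) : \bar R := (\1_(`]0%R, x]%classic : set R) t)%:E.
have mK : measurable_fun (`]0%R, +oo[%classic : set (measurableTypeR R)) K.
  by apply/measurable_EFinP; apply: measurable_indic.
have WE (y : R) (L : R -> \bar R) :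
    (forall t, (0 < t)%R -> L t = (\1_(`]0%R, y]%classic : set R) t)%:E) ->
    \int[lambda]_(t in `]0%R, +oo[) (L t * (w t)%:E) = W y.
  move=> LE; rewrite /W -(setIidr (@subset_itv0_pos y)) integral_mkcondr.
  apply: eq_integral => t; rewrite inE/= in_itv/= andbT => t0.
  by rewrite LE// patchE indicE; case: ifP => _; rewrite ?mul1e ?mul0e.
rewrite -(WE x K)// -(WE (2 * x)%R (fun t => K (t / 2)%R)); last first.
  move=> t t0.
  by rewrite /K !indicE !mem_setE !in_itv/= divr_gt0// t0 ler_pdivrMr// mulrC.
by apply: weighted_integral_half => // t _; rewrite lee_fin.
Qed.

End weights.

(** * Modulars *)

Section modulars.
Variables (R : realType) (w phi : R -> R).
Hypotheses (w_weight : weight_function w) (phi_orlicz : orlicz_function phi).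
Implicit Types f g h : L0 R.
Local Notation lambda := (@lebesgue_measure R).
Local Notation W := (weight_primitive w).
Local Open Scope ereal_scope.

Lemma measurable_modular_integrand f :
  measurable_fun (`]0%R, +oo[%classic : set (measurableTypeR R))
    (fun t => er_map phi (rearrangement f t) * (w t)%:E).
Proof.
apply: emeasurable_funM; last exact: measurable_weight.
apply: nonincreasing_emeasurable; first exact: interval_is_interval.
move=> s t _ _ st; apply: er_map_orlicz_le => //; first exact: rearrangement_ge0.
exact: rearrangement_nonincreasing.
Qed.

Lemma modular_integrand_ge0 f t : (0 < t)%R ->
  0 <= er_map phi (rearrangement f t) * (w t)%:E.
Proof.
move=> t0; rewrite mule_ge0//; last exact: weight_ge0.
by rewrite er_map_orlicz_ge0// rearrangement_ge0.
Qed.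

Lemma modularE f : modular phi w f =
  \int[lambda]_(t in `]0%R, +oo[) (er_map phi (rearrangement f t) * (w t)%:E).
Proof. by rewrite /modular integral_half_line//; exact: measurable_modular_integrand. Qed.

Lemma modular_ge0 f : 0 <= modular phi w f.
Proof.
rewrite modularE; apply: integral_ge0 => t; rewrite /= in_itv/= andbT.
exact: modular_integrand_ge0.
Qed.

Lemma modular_le f g : {ae leb_I R, forall t, (`|g t| <= `|f t|)%R} ->
  modular phi w g <= modular phi w f.
Proof.
move=> gf; rewrite !modularE; apply: ge0_le_integral => //.
- by move=> t; rewrite /= in_itv/= andbT; exact: modular_integrand_ge0.
- exact: measurable_modular_integrand.
- exact: measurable_modular_integrand.
- move=> t; rewrite /= in_itv/= andbT => t0.
  apply: lee_wpmul2r; first exact: weight_ge0.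
  apply: er_map_orlicz_le => //; first exact: rearrangement_ge0.
  apply: rearrangement_le_fun => l l0; apply: le_trans.
  exact: distribution_function_le.
Qed.

(** Where [f] exceeds [l] on a set of measure more than [x], its rearrangement
    is at least [l] on [`]0, x]]. *)
Lemma modular_ge f (l x : R) : (0 < l)%R -> x%:E < distribution_function f l ->
  (phi l)%:E * W x <= modular phi w f.
Proof.
move=> l0 xf; rewrite modularE.
apply: (@le_trans _ _ (\int[lambda]_(t in `]0%R, x])
  (er_map phi (rearrangement f t) * (w t)%:E))); last first.
  apply: ge0_subset_integral => //.
  - exact: measurable_modular_integrand.
  - by move=> t; rewrite /= in_itv/= andbT; exact: modular_integrand_ge0.
  - exact: subset_itv0_pos.
have mw : measurable_fun (`]0%R, x]%classic : set (measurableTypeR R)) (EFin \o w).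
  by apply: measurable_weight => //; exact: subset_itv0_pos.
have w0 (t : R) : `]0%R, x]%classic t -> 0 <= (EFin \o w) t.
  by rewrite /= in_itv/= => /andP[t0 _]; exact: weight_ge0.
have phil0 : 0 <= (phi l)%:E by rewrite lee_fin orlicz_ge0// ltW.
rewrite /weight_primitive -ge0_integralZl//; apply: ge0_le_integral => //.
- by move=> t xt; rewrite mule_ge0// w0.
- by apply: emeasurable_funM.
- apply: measurable_funS (measurable_modular_integrand f) => //.
  exact: subset_itv0_pos.
- move=> t; rewrite /= in_itv/= => /andP[t0 tx].
  apply: lee_wpmul2r; first exact: weight_ge0.
  rewrite -[leLHS]/(er_map phi l%:E); apply: er_map_orlicz_le => //.
    by rewrite lee_fin ltW.
  by apply: rearrangement_ge; apply: le_lt_trans xf; rewrite lee_fin.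
Qed.

(** The rearrangement is not subadditive: [rearrangement_max] costs a dilation
    of the argument, and the decreasing weight absorbs it at the price of a
    factor 2. This replaces the convexity of the modular, for which one would
    have to compare integrals of rearrangements. *)
Lemma modular_max f g h :
  {ae leb_I R, forall t, (`|h t| <= Num.max `|f t| `|g t|)%R} ->
  modular phi w h <= 2%:E * (modular phi w f + modular phi w g).
Proof.
move=> hfg.
pose K t := er_map phi (rearrangement f t) + er_map phi (rearrangement g t).
have phif0 u t : 0 <= er_map phi (rearrangement u t).
  by rewrite er_map_orlicz_ge0// rearrangement_ge0.
have mphi u : measurable_fun (`]0%R, +oo[%classic : set (measurableTypeR R))
    (fun t => er_map phi (rearrangement u t)).
  apply: nonincreasing_emeasurable; first exact: interval_is_interval.
  move=> s t _ _ st; apply: er_map_orlicz_le => //; first exact: rearrangement_ge0.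
  exact: rearrangement_nonincreasing.
have mK : measurable_fun (`]0%R, +oo[%classic : set (measurableTypeR R)) K.
  exact: emeasurable_funD.
have K0 t : 0 <= K t by rewrite adde_ge0.
have -> : modular phi w f + modular phi w g =
    \int[lambda]_(t in `]0%R, +oo[) (K t * (w t)%:E).
  rewrite !modularE -ge0_integralD//=.
  - apply: eq_integral => t; rewrite inE/= in_itv/= andbT => t0.
    by rewrite /K ge0_muleDl.
  - by move=> t; rewrite in_itv/= andbT; exact: modular_integrand_ge0.
  - exact: measurable_modular_integrand.
  - by move=> t; rewrite in_itv/= andbT; exact: modular_integrand_ge0.
  - exact: measurable_modular_integrand.
apply: le_trans (weighted_integral_half w_weight mK (fun t _ => K0 t)).
rewrite modularE; apply: ge0_le_integral => //.
- by move=> t; rewrite /= in_itv/= andbT; exact: modular_integrand_ge0.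
- exact: measurable_modular_integrand.
- apply: emeasurable_funM; last exact: measurable_weight.
  apply: nonincreasing_emeasurable; first exact: interval_is_interval.
  move=> s t _ _ st; apply: leeD; apply: er_map_orlicz_le => //;
    by [exact: rearrangement_ge0|apply: rearrangement_nonincreasing; lra].
- move=> t; rewrite /= in_itv/= andbT => t0.
  apply: lee_wpmul2r; first exact: weight_ge0.
  apply: (le_trans (er_map_orlicz_le phi_orlicz (rearrangement_ge0 h t)
    (rearrangement_max t hfg))).
  by rewrite /K maxEle; case: ifP => _; [exact: leeDr|exact: leeDl].
Qed.

(** Since [F] decreases, [f] exceeds [F t] on [[0, t]] only, so that [F t] bounds
    the rearrangement at [t]. *)
Lemma modular_le_integral f (F : R -> R) :
  (forall t, (0 < t)%R -> (0 < F t)%R) ->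
  (forall s t, (0 < s)%R -> (s <= t)%R -> (F t <= F s)%R) ->
  {ae leb_I R, forall t, half_line t -> (`|f t| <= F t)%R} ->
  modular phi w f <= \int[lambda]_(t in `]0%R, +oo[) ((phi (F t))%:E * (w t)%:E).
Proof.
move=> F0 Fni fF; rewrite modularE; apply: ge0_le_integral => //.
- by move=> t; rewrite /= in_itv/= andbT; exact: modular_integrand_ge0.
- exact: measurable_modular_integrand.
- apply: emeasurable_funM; last exact: measurable_weight.
  apply: nonincreasing_emeasurable; first exact: interval_is_interval.
  move=> s t; rewrite /= !in_itv/= !andbT => s0 t0 st; rewrite lee_fin.
  by apply: orlicz_le => //; [rewrite ltW// F0|exact: Fni].
move=> t; rewrite /= in_itv/= andbT => t0.
apply: lee_wpmul2r; first exact: weight_ge0.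
rewrite -[leRHS]/(er_map phi (F t)%:E).
apply: er_map_orlicz_le => //; first exact: rearrangement_ge0.
apply: rearrangement_le; first exact: F0.
have mB : measurable (`[0%R, t]%classic : set (lebesgue_type R)).
  exact: borel_lebesgue_measurable.
apply: (@le_trans _ _ (leb_I R `[0%R, t]%classic)).
  apply: ae_le_measure => //; first exact: measurable_L0_norm_gt.
  move: (ae_half_line R) fF; apply: filterS2 => s sI /(_ sI) sF /= Fs.
  move: sI; rewrite /half_line/= !in_itv/= andbT => s0; rewrite s0/=.
  rewrite leNgt; apply/negP => ts.
  by have := lt_le_trans Fs (le_trans sF (Fni _ _ t0 (ltW ts))); rewrite ltxx.
apply: (@le_trans _ _ (leb R `[0%R, t]%classic)).
  have mBI : measurable (`[0%R, t]%classic `&` @half_line R : set (lebesgue_type R)).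
    by apply: measurableI mB _; exact: measurable_half_line.
  by apply: le_measure; rewrite ?inE//; exact: subIsetl.
rewrite [leLHS](lebesgue_measure_itv `[0%R, t])/= lte_fin t0.
by rewrite sube0.
Qed.

End modulars.

(** * Orlicz-Lorentz spaces and their norm *)

Section L0_norms.
Variable R : realType.
Implicit Types f g : L0 R.

Lemma ae_normZ (k : R) f :
  {ae leb_I R, forall t, `|(k *: f : L0 R) t| = `|k| * `|f t|}.
Proof. by apply: filterS (L0_funZ k f) => t ->; rewrite ?normrM. Qed.

Lemma ae_normD_le f g :
  {ae leb_I R, forall t, `|(f + g : L0 R) t| <= `|f t| + `|g t|}.
Proof. by apply: filterS (L0_funD f g) => t ->; rewrite ?ler_normD. Qed.

Lemma ae_normZ_le (k k' : R) f : `|k| <= `|k'| ->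
  {ae leb_I R, forall t, `|(k *: f : L0 R) t| <= `|(k' *: f : L0 R) t|}.
Proof.
move=> kk'; move: (ae_normZ k f) (ae_normZ k' f); apply: filterS2 => t -> ->.
by rewrite ler_wpM2r.
Qed.

Lemma ae_normZ_mono (k : R) f g :
  {ae leb_I R, forall t, `|g t| <= `|f t|} ->
  {ae leb_I R, forall t, `|(k *: g : L0 R) t| <= `|(k *: f : L0 R) t|}.
Proof.
move: (ae_normZ k f) (ae_normZ k g); apply: filterS3 => t -> -> gf.
by rewrite ler_wpM2l.
Qed.

End L0_norms.

Lemma double_add_lty (R : realType) (x y : \bar R) :
  (x < +oo -> y < +oo -> 2%:E * (x + y) < +oo)%E.
Proof. by move=> xoo yoo; rewrite lte_mul_pinfty// lte_add_pinfty. Qed.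

Section orlicz_lorentz_spaces.
Variables (R : realType) (w phi : R -> R).
Hypotheses (w_weight : weight_function w) (phi_orlicz : orlicz_function phi).
Implicit Types f g h x y : L0 R.
Local Notation lambda := (@lebesgue_measure R).
Local Notation W := (weight_primitive w).
Local Notation rho := (modular phi w).
Local Open Scope ereal_scope.

Lemma modular0 : rho (0 : L0 R)%R = 0.
Proof.
have d0 (l : R) : (0 < l)%R -> distribution_function (0 : L0 R)%R l = 0.
  move=> l0; apply/eqP; rewrite eq_le measure_ge0 andbT.
  rewrite -(measure0 (leb_I R)); apply: ae_le_measure => //.
    exact: measurable_L0_norm_gt.
  apply: filterS (L0_fun0 R) => t /(_ Logic.I) f0 /=.
  by rewrite f0 normr0 ltNge (ltW l0).
have r0 t : (0 < t)%R -> rearrangement (0 : L0 R)%R t = 0.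
  move=> t0; apply/eqP; rewrite eq_le rearrangement_ge0 andbT.
  apply/lee_addgt0Pr => e e0; rewrite add0e; apply: rearrangement_le => //.
  by rewrite d0// lee_fin ltW.
rewrite modularE// integral0_eq// => t; rewrite /= in_itv/= andbT => t0.
by rewrite r0//=; case: phi_orlicz => _ -> _ _; rewrite mul0e.
Qed.

(** The sum is at most twice the larger term. *)
Lemma modularD_le f g : rho (f + g)%R <= 2%:E * (rho (2 *: f)%R + rho (2 *: g)%R).
Proof.
apply: modular_max => //; move: (ae_normD_le f g) (ae_normZ 2 f) (ae_normZ 2 g).
apply: filterS3 => t fg -> ->; apply: (le_trans fg).
by rewrite normr_nat le_max; case: (leP (`|f t|)%R (`|g t|)%R) => ?; apply/orP; [right|left]; lra.
Qed.

Lemma modularD_lty f g : rho (2 *: f)%R < +oo -> rho (2 *: g)%R < +oo ->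
  rho (f + g)%R < +oo.
Proof.
move=> foo goo; apply: (le_lt_trans (modularD_le f g)).
exact: double_add_lty.
Qed.

Lemma modularZ_lty (k k' : R) f : (`|k| <= `|k'|)%R ->
  rho (k' *: f)%R < +oo -> rho (k *: f)%R < +oo.
Proof. by move=> kk'; apply: le_lt_trans; apply: modular_le => //; exact: ae_normZ_le. Qed.

Lemma linear_orlicz_lorentz : linear_subspace (orlicz_lorentz phi w).
Proof.
split; first by exists 1%R => //; rewrite scaler0 modular0.
move=> a x y [k k0 xk] [k' k'0 yk'].
have a0 : (0 < 2 * (`|a| + 1))%R by have := normr_ge0 a; lra.
exists (Num.min (k / (2 * (`|a| + 1))) (k' / 2))%R.
  by rewrite lt_min !divr_gt0.
set m := Num.min _ _; have m0 : (0 < m)%R by rewrite lt_min !divr_gt0.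
have mk : (m * (2 * (`|a| + 1)) <= k)%R by rewrite -ler_pdivlMr// ge_min lexx.
have mk' : (m * 2 <= k')%R by rewrite -ler_pdivlMr// ge_min lexx orbT.
rewrite scalerDr scalerA; apply: modularD_lty; rewrite scalerA.
  apply: modularZ_lty xk; rewrite !normrM (gtr0_norm m0) (gtr0_norm k0) ger0_norm//.
  by have := normr_ge0 a; nra.
by apply: modularZ_lty yk'; rewrite normrM (gtr0_norm m0) (gtr0_norm k'0) ger0_norm//; lra.
Qed.

(** The usual description of the order continuous part by the modular. *)
Definition modular_heart : set (L0 R) :=
  [set f | forall k : R, (0 < k)%R -> rho (k *: f)%R < +oo].

Lemma linear_modular_heart : linear_subspace modular_heart.
Proof.
split; first by move=> k k0; rewrite scaler0 modular0.
move=> a x y xh yh k k0; rewrite scalerDr scalerA.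
apply: modularD_lty; rewrite scalerA; last by apply: yh; lra.
apply: (@modularZ_lty _ (`|2 * (k * a)| + 1)%R).
  by rewrite [leRHS]ger0_norm; have := normr_ge0 (2 * (k * a))%R; lra.
by apply: xh; have := normr_ge0 (2 * (k * a))%R; lra.
Qed.

Lemma luxemburg_ge0 f : 0 <= luxemburg phi w f.
Proof. by apply: le_ereal_inf_tmp => _ [e [e0 _] <-]; rewrite lee_fin ltW. Qed.

Lemma luxemburg_le f (e : R) : (0 < e)%R -> rho (e^-1 *: f)%R <= 1 ->
  luxemburg phi w f <= e%:E.
Proof. by move=> e0 fe; apply: ereal_inf_lbound; exists e. Qed.

Lemma luxemburg_lt f (e : R) : luxemburg phi w f < e%:E -> rho (e^-1 *: f)%R <= 1.
Proof.
move=> /ereal_inf_lt[_ [r [r0 fr] <-]]; rewrite lte_fin => re.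
apply: le_trans fr; apply: modular_le => //; apply: ae_normZ_le.
have e0 : (0 < e)%R by lra.
by rewrite !gtr0_norm ?invr_gt0// lef_pV2// ltW.
Qed.

Lemma luxemburg_le_fun f g : {ae leb_I R, forall t, (`|g t| <= `|f t|)%R} ->
  luxemburg phi w g <= luxemburg phi w f.
Proof.
move=> gf; apply: le_ereal_inf_tmp => _ [e [e0 fe] <-]; apply: (luxemburg_le e0).
by apply: le_trans fe; apply: modular_le => //; exact: ae_normZ_mono.
Qed.

(** Write [k *: x] as [k *: (x - y) + k *: y] with [y] so close to [x] that
    [2 * k *: (x - y)] has modular at most 1. *)
Lemma modular_heart_closed x :
  (forall e : R, (0 < e)%R -> exists2 y, modular_heart y & luxemburg phi w (x - y)%R < e%:E) ->
  modular_heart x.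
Proof.
move=> xcl k k0; have k20 : (0 < (2 * k)^-1)%R by rewrite invr_gt0; lra.
have [y yh /luxemburg_lt] := xcl _ k20; rewrite invrK => xy.
rewrite -[x](subrK y) scalerDr; apply: modularD_lty; rewrite scalerA.
  exact: le_lt_trans xy (ltry _).
by apply: yh; lra.
Qed.

(** If [g] exceeds [l] on a set of measure more than [d], the modular of
    [e^-1 *: g] is at least [phi (l / e) * W d >= phi l * W d / e], which is above
    1 for small [e]. So norm convergence implies convergence in measure. *)
Lemma luxemburg_small (l d : R) : (0 < l)%R -> (0 < d)%R ->
  exists2 e : R, (0 < e)%R & forall g, luxemburg phi w g < e%:E ->
    distribution_function g l <= d%:E.
Proof.
move=> l0 d0.
have Wd0 := weight_primitive_gt0 w_weight d0.
have WdE : W d = (fine (W d))%:E.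
  by rewrite fineK// ge0_fin_numE ?weight_primitive_lty// ltW.
have fWd0 : (0 < fine (W d))%R by rewrite -lte_fin -WdE.
have pl0 : (0 < phi l)%R by case: phi_orlicz => _ _ _; apply.
pose e := Num.min 1%R (phi l * fine (W d) / 2)%R.
have e0 : (0 < e)%R by rewrite lt_min ltr01 divr_gt0// mulr_gt0.
exists e => // g /luxemburg_lt ge1; rewrite leNgt; apply/negP => dg.
have : (phi (e^-1 * l))%:E * W d <= rho (e^-1 *: g)%R.
  apply: modular_ge => //; first by rewrite mulr_gt0// invr_gt0.
  apply: (lt_le_trans dg); apply: ae_le_measure; try exact: measurable_L0_norm_gt.
  apply: filterS (ae_normZ e^-1 g) => t /= ->.
  have ei0 : (0 < e^-1)%R by rewrite invr_gt0.
  by rewrite (gtr0_norm ei0) ltr_pM2l.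
move=> /le_trans-/(_ _ ge1); rewrite leNgt => /negP; apply.
rewrite WdE -EFinM lte_fin.
have e1 : (1 <= e^-1)%R by rewrite invf_ge1// ge_min lexx.
have := orlicz_scale_ge phi_orlicz e1 (ltW l0) => h.
apply: (@lt_le_trans _ _ (e^-1 * phi l * fine (W d))%R); last first.
  by rewrite ler_wpM2r// ltW.
rewrite -mulrA ltr_pdivlMl// mulr1.
have : (e <= phi l * fine (W d) / 2)%R by rewrite ge_min lexx orbT.
have : (0 < phi l * fine (W d))%R by rewrite mulr_gt0.
lra.
Qed.

(** Otherwise the rearrangement of [f] would be at least [l] everywhere, while
    the weight is not integrable at infinity. *)
Lemma distribution_function_lty f (l : R) : (0 < l)%R -> rho f < +oo ->
  distribution_function f l < +oo.
Proof.
move=> l0 foo; rewrite ltey; apply/negP => /eqP foo'.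
have pl0 : (0 < phi l)%R by case: phi_orlicz => _ _ _; apply.
have [n An] := weight_primitive_unbounded w_weight (fine (rho f) / phi l).
have : (phi l)%:E * W n%:R <= rho f by apply: modular_ge => //; rewrite foo' ltry.
rewrite leNgt => /negP; apply.
have -> : rho f = (phi l)%:E * (fine (rho f) / phi l)%:E.
  rewrite -EFinM mulrC divfK ?gt_eqF// fineK// ge0_fin_numE//.
  exact: modular_ge0.
by rewrite lte_pmul2l.
Qed.

End orlicz_lorentz_spaces.

(** * Order continuity *)

Lemma ge0_cvge0P (R : realType) (u : nat -> \bar R) :
  (forall n, 0 <= u n)%E ->
  (u @ \oo --> 0%E) <->
  (forall e : R, 0 < e -> \forall n \near \oo, (u n <= e%:E)%E).
Proof.
move=> u0; split=> [/fine_cvgP[ufin ucvg] e e0|ue].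
  move/cvgrPdist_le : ucvg => /(_ e e0) ule; near=> n.
  have un : u n \is a fin_num by near: n.
  rewrite -(fineK un) lee_fin; have : `|0 - fine (u n)| <= e by near: n.
  by rewrite sub0r normrN ger0_norm// fine_ge0.
apply/fine_cvgP; split.
  apply: filterS (ue 1 ltr01) => n un; rewrite ge0_fin_numE//.
  exact: le_lt_trans un (ltry _).
apply/cvgrPdist_le => e e0; apply: filterS (ue e e0) => n un /=.
have ufin : u n \is a fin_num by rewrite ge0_fin_numE// (le_lt_trans un) ?ltry.
by rewrite sub0r normrN ger0_norm ?fine_ge0// -lee_fin fineK.
Unshelve. all: by end_near. Qed.

Section order_continuity.
Variables (R : realType) (w phi : R -> R).
Hypotheses (w_weight : weight_function w) (phi_orlicz : orlicz_function phi).
Implicit Types f : L0 R.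
Local Notation lambda := (@lebesgue_measure R).
Local Notation rho := (modular phi w).
Local Open Scope ereal_scope.

(** The sets where some [g m], [m >= n], exceeds [l] decrease to a null set, and
    they lie in a set of finite measure. *)
Lemma distribution_function_cvg0 f (g : nat -> L0 R) (l : R) :
  distribution_function f l < +oo ->
  (forall n, {ae leb_I R, forall t, (`|g n t| <= `|f t|)%R}) ->
  {ae leb_I R, forall t, (fun n => `|g n t|%R) @ \oo --> (0 : R)%R} ->
  (0 < l)%R -> (fun n => distribution_function (g n) l) @ \oo --> 0.
Proof.
move=> foo gf g0 l0.
pose A n : set (lebesgue_type R) := [set t | (l < `|g n t|)%R].
pose B n := \bigcup_(m in [set m | (n <= m)%N]) A m.
have mA n : measurable (A n) by exact: measurable_L0_norm_gt.
have mB n : measurable (B n) by apply: bigcup_measurable => m _.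
have mBI : measurable (\bigcap_n B n) by apply: bigcapT_measurable.
have nB : nonincreasing_seq B.
  by move=> m n mn; apply/subsetPset => t [k /= nk Ak]; exists k => //=; exact: leq_trans nk.
have B0oo : leb_I R (B 0%N) < +oo.
  apply: le_lt_trans foo; apply: ae_le_measure => //.
    exact: measurable_L0_norm_gt.
  move: (ae_foralln gf); apply: filterS => t gft [m _ /=] lg.
  exact: (lt_le_trans lg (gft m)).
have BI0 : leb_I R (\bigcap_n B n) = 0.
  apply/eqP; rewrite eq_le measure_ge0 andbT -(measure0 (leb_I R)).
  apply: ae_le_measure => //.
  apply: filterS g0 => t /cvgrPdist_lt/(_ l l0)[N _ gN] BIt.
  have [m /= Nm] := BIt N Logic.I.
  have := gN m Nm; rewrite /A/= sub0r normrN normr_id => /ltW.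
  by rewrite leNgt => /negP.
have := nonincreasing_cvg_mu B0oo mB mBI nB; rewrite BI0 => Bcvg.
apply: (squeeze_cvge _ (cvg_cst 0) Bcvg); near=> n.
rewrite measure_ge0/=; apply: le_measure.
- exact/mem_set/measurable_L0_norm_gt.
- exact: mem_set.
- by move=> t gt; exists n => /=.
Unshelve. all: by end_near. Qed.

(** Dominated convergence for the modulars of [e^-1 *: g n], for each [e]: the
    distribution functions tend to 0, hence so do the rearrangements, and the
    integrand of [e^-1 *: f] is a dominating function. *)
Lemma modular_heart_order_continuous :
  modular_heart w phi `<=` order_continuous_part phi w.
Proof.
move=> f fh; split; first by exists 1%R => //; exact: fh.
move=> g gf gd.
have lux_ni : nonincreasing_seq (fun n => luxemburg phi w (g n)).
  move=> m n mn; apply: luxemburg_le_fun => //.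
  by apply: filterS gd => t [gni _]; exact: gni.
split=> //.
have goal (e : R) : (0 < e)%R -> exists n, luxemburg phi w (g n) <= e%:E.
  move=> e0.
  have ei0 : (0 < e^-1)%R by rewrite invr_gt0.
  have foo := fh _ ei0.
  pose F n t := er_map phi (rearrangement (e^-1 *: g n)%R t) * (w t)%:E.
  have mF n : measurable_fun (`]0%R, +oo[%classic : set (measurableTypeR R)) (F n).
    exact: measurable_modular_integrand.
  have F0 n (t : R) : `]0%R, +oo[%classic t -> 0 <= F n t.
    by rewrite /= in_itv/= andbT; exact: modular_integrand_ge0.
  pose G t := er_map phi (rearrangement (e^-1 *: f)%R t) * (w t)%:E.
  have mG : measurable_fun (`]0%R, +oo[%classic : set (measurableTypeR R)) G.
    exact: measurable_modular_integrand.
  have G0 (t : R) : `]0%R, +oo[%classic t -> 0 <= G t.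
    by rewrite /= in_itv/= andbT; exact: modular_integrand_ge0.
  have gf' n := ae_normZ_mono e^-1 (gf n).
  have iG : lambda.-integrable `]0%R, +oo[ G.
    apply/integrableP; split; first exact: mG.
    apply: le_lt_trans foo; rewrite modularE//.
    by rewrite le_eqVlt; apply/orP; left; apply/eqP/eq_integral => t; rewrite inE => /G0 /gee0_abs.
  have FG : {ae lambda, forall x n, `]0%R, +oo[%classic x -> `|F n x| <= G x}.
    apply: aeW => t n t0; rewrite gee0_abs ?F0//.
    move: t0; rewrite /= in_itv/= andbT => t0.
    apply: lee_wpmul2r; first exact: weight_ge0.
    apply: er_map_orlicz_le => //; first exact: rearrangement_ge0.
    apply: rearrangement_le_fun => l l0; apply: le_trans.
    exact: distribution_function_le.
  have g0' : {ae leb_I R, forall t, (fun n => `|(e^-1 *: g n : L0 R)%R t|%R) @ \oo --> (0 : R)%R}.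
    move: (ae_foralln (fun n => ae_normZ e^-1 (g n))) gd.
    apply: filterS2 => t gE [_ gt0].
    rewrite [X in X @ \oo --> _](_ : _ = fun n => (`|e^-1| * `|g n t|)%R); last exact/funext.
    by rewrite -(mulr0 `|e^-1|%R); apply: cvgMr.
  have F_cvg : {ae lambda, forall x, `]0%R, +oo[%classic x -> F ^~ x @ \oo --> 0}.
    apply: aeW => t; rewrite /= in_itv/= andbT => t0.
    have wt0 := weight_gt0 w_weight t0.
    apply/ge0_cvge0P => [n|d d0]; first by apply: F0; rewrite /= in_itv/= t0.
    have [l l0 phil] := orlicz_near0 phi_orlicz (divr_gt0 d0 wt0).
    have : (fun n => distribution_function (e^-1 *: g n)%R l) @ \oo --> 0.
      apply: (distribution_function_cvg0 _ gf' g0' l0).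
      exact: (distribution_function_lty w_weight phi_orlicz l0 foo).
    move=> /ge0_cvge0P-/(_ (fun n => measure_ge0 _ _) _ t0).
    apply: filterS => n dn.
    rewrite /F -[d](divfK (lt0r_neq0 wt0)) EFinM; apply: lee_wpmul2r.
      exact: weight_ge0.
    apply: (@le_trans _ _ (er_map phi l%:E)).
      apply: er_map_orlicz_le => //; first exact: rearrangement_ge0.
      exact: rearrangement_le.
    by rewrite /= lee_fin; apply: phil; rewrite lexx ltW.
  have [_ _] := @dominated_convergence _ (measurableTypeR R) R lambda _
    (measurable_itv _) F (cst 0) G mF (measurable_cst 0) F_cvg iG FG.
  rewrite integral0 => /ge0_cvge0P-/(_ _ 1%R ltr01)[].
    by move=> n; apply: integral_ge0 => t; exact: F0.
  move=> n _ /(_ n (leqnn n)) Fn; exists n; apply: luxemburg_le => //.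
  by rewrite modularE.
apply/ge0_cvge0P => [n|e e0]; first exact: luxemburg_ge0.
have [N gN] := goal e e0; near=> n.
apply: le_trans gN; apply: lux_ni; near: n; exact: nbhs_infty_ge.
Unshelve. all: by end_near. Qed.

End order_continuity.

(** * Choice of the blocks *)

Section blocks_choice.
Variables (R : realType) (phi : R -> R) (phin : nat -> R -> R) (V : R -> R).
Hypothesis phi_orlicz : orlicz_function phi.
Hypothesis phin_Delta : forall n, (1 <= n)%N -> Delta_zero phi (phin n).
Hypothesis V_le : forall x y, x <= y -> V x <= V y.
Hypothesis V_double : forall x, V (2 * x) <= 2 * V x.
Hypothesis V_ge0 : forall x, 0 <= V x.
Hypothesis V_unbounded : forall A, exists n : nat, A < V n%:R.

(** The condition of each [phin n] is used with a parameter [b] that has the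
    factor [K] hidden in it: then [K * phi (J * u) <= phi (K * J * u)], which is
    at most [phin n (u / J)]. *)
Lemma Delta_zero_dominated (J : nat) (K : R) : (0 < J)%N -> 1 <= K ->
  exists2 v, 0 < v & forall n u, (1 <= n <= J)%N -> 0 <= u <= v ->
    K * phi (J%:R * u) <= phin n (u / J%:R).
Proof.
move=> J0 K1; have J0' : 0 < J%:R :> R by rewrite ltr0n.
have K0 : 0 < K by lra.
have KJ0 : 0 < K * J%:R by rewrite mulr_gt0.
suff [v v0 H] : exists2 v, 0 < v & forall n u, (1 <= n <= J)%N -> 0 <= u <= v ->
    phi u <= phin n ((J%:R * (K * J%:R))^-1 * u).
  exists (v / (K * J%:R)); first by rewrite divr_gt0.
  move=> n u nJ /andP[u0 uv].
  apply: (@le_trans _ _ (phi (K * J%:R * u))).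
    by rewrite -mulrA; apply: orlicz_scale_ge => //; rewrite mulr_ge0// ltW.
  have -> : u / J%:R = (J%:R * (K * J%:R))^-1 * (K * J%:R * u).
    by field; rewrite !lt0r_neq0.
  apply: H => //; rewrite (mulr_ge0 (ltW KJ0) u0)/=.
  by rewrite mulrC -ler_pdivlMr.
have b0 : 0 < (J%:R * (K * J%:R))^-1 by rewrite invr_gt0 mulr_gt0.
elim: {1}J => [|m [v v0 IH]].
  by exists 1 => // n u /andP[n1]; rewrite leqNgt n1.
have [v' v'0 H] := phin_Delta (ltn0Sn m) b0.
exists (Num.min v v'); first by rewrite lt_min v0.
move=> n u /andP[n1]; rewrite leq_eqVlt => /predU1P[->|nm] /andP[u0].
  by rewrite le_min => /andP[_ uv']; apply: H; rewrite u0.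
by rewrite le_min => /andP[uv _]; apply: IH; rewrite ?u0// n1.
Qed.

(** Given [u0] and [s], the value [u] is taken so small that the first [N] with
    [phi (J * u) * V (N + 1)] above [2 ^- J] lies beyond [2 * s]. Halving [N]
    costs a factor 4 at most, which [K] compensates. *)
Lemma block_step (J s : nat) (u0 : R) : (0 < J)%N -> 0 < u0 ->
  exists u N, [/\ 0 < u <= u0, (s.*2 < N)%N,
    phi (J%:R * u) * V N%:R <= 2^-1 ^+ J &
    forall n, (1 <= n <= J)%N -> J%:R <= phin n (u / J%:R) * V (N%:R / 2)].
Proof.
move=> J0 u00; have J0' : 0 < J%:R :> R by rewrite ltr0n.
pose q : R := 2^-1 ^+ J; have q0 : 0 < q by rewrite exprn_gt0// invr_gt0.
have q1 : q <= 1 by rewrite exprn_ile1// ?invf_le1// ?invr_ge0// ler1n.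
pose K : R := 4 * J%:R / q.
have K1 : 1 <= K.
  rewrite ler_pdivlMr// mul1r (le_trans q1)//.
  have J1 : 1 <= J%:R :> R by rewrite ler1n.
  by lra.
have [v v0 Hv] := Delta_zero_dominated J0 K1.
pose Vs := V (2 * s%:R + 2).
have Vs0 : 0 <= Vs by exact: V_ge0.
have Vs1 : 0 < Vs + 1 by lra.
have eps0 : 0 < q / (Vs + 1) by rewrite divr_gt0.
have [d d0 Hd] := orlicz_near0 phi_orlicz eps0.
pose u := Num.min u0 (Num.min v (d / J%:R)).
have u_gt0 : 0 < u by rewrite !lt_min u00 v0 divr_gt0.
have uv : u <= v by rewrite /u ge_min [X in _ || X]ge_min lexx orbT.
have ud : J%:R * u <= d.
  by rewrite mulrC -ler_pdivlMr// /u ge_min [X in _ || X]ge_min lexx !orbT.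
have c0 : 0 < phi (J%:R * u) by case: phi_orlicz => _ _ _; apply; rewrite mulr_gt0.
set c := phi (J%:R * u) in c0 *.
have cs : c * Vs <= q.
  have : c <= q / (Vs + 1) by apply: Hd; rewrite ud mulr_ge0// ltW.
  rewrite ler_pdivlMr//.
  by move=> h; apply: le_trans h; rewrite ler_pM2l// lerDl.
pose P N := q < c * V N.+1%:R.
have exP : exists N, P N.
  have [N VN] := V_unbounded (q / c); exists N.
  rewrite /P mulrC -ltr_pdivrMr//; apply: (lt_le_trans VN).
  by apply: V_le; rewrite ler_nat.
have [N PN minN] := ex_minnP exP.
have sN : (s.*2 < N)%N.
  rewrite ltnNge; apply/negP => Ns; move: PN; rewrite /P ltNge => /negP; apply.
  apply: le_trans cs; rewrite ler_pM2l//; apply: V_le.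
  rewrite -natrM -natrD ler_nat mul2n addn2 ltnS.
  exact: leq_trans Ns (leqnSn _).
have N0 : (0 < N)%N by exact: leq_ltn_trans sN.
exists u, N; split=> //.
- by rewrite u_gt0 /u ge_min lexx.
- rewrite -/q leNgt; apply/negP => h.
  have : P N.-1 by rewrite /P prednK.
  by move=> /minN; rewrite leqNgt ltn_predL N0.
- move=> n nJ.
  have /Hv-/(_ u) : (1 <= n <= J)%N by [].
  rewrite (ltW u_gt0) uv -/c => /(_ isT) h.
  apply: (@le_trans _ _ (K * c * V (N%:R / 2))); last by rewrite ler_wpM2r.
  have VN4 : V N.+1%:R <= 4 * V (N%:R / 2).
    apply: (@le_trans _ _ (V (2 * N%:R))).
      by apply: V_le; rewrite -natrM ler_nat mul2n -addnn -addn1 leq_add2l.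
    apply: (le_trans (V_double _)).
    have : V N%:R <= 2 * V (N%:R / 2).
      by rewrite -{1}[N%:R](@divfK _ 2)// mulrC; exact: V_double.
    lra.
  have : q < c * (4 * V (N%:R / 2)).
    by apply: (lt_le_trans PN); rewrite ler_pM2l.
  rewrite /K => qh.
  have -> : 4 * J%:R / q * c * V (N%:R / 2) = J%:R * (c * (4 * V (N%:R / 2)) / q).
    by field; rewrite gt_eqF.
  by rewrite ler_peMr ?ltW// ltr_pdivlMr// mul1r.
Qed.

(** A function equal to [u j] on [[s (j - 1), s j[] then decreases, and its
    multiples have finite [phi]-modulars because the bounds [2 ^- (j + 1)] have a
    finite sum. Since each block is longer than [s j / 2], the last condition
    makes the [phin n]-modulars infinite, even of the restriction to infinitely
    many blocks. *)
Lemma blocks_exist : exists (u : nat -> R) (s : nat -> nat),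
  [/\ forall j, 0 < u j /\ u j.+1 <= u j, (0 < s 0%N)%N,
      forall j, ((s j).*2 < s j.+1)%N,
      forall j, phi (j.+1%:R * u j) * V (s j)%:R <= 2^-1 ^+ j.+1 &
      forall j n, (1 <= n <= j.+1)%N ->
        j.+1%:R <= phin n (u j / j.+1%:R) * V ((s j)%:R / 2)].
Proof.
have [next nextP] : exists next : nat -> R * nat -> R * nat,
    forall j us, 0 < us.1 -> [/\ 0 < (next j us).1 <= us.1,
    (us.2.*2 < (next j us).2)%N,
    phi (j.+1%:R * (next j us).1) * V (next j us).2%:R <= 2^-1 ^+ j.+1 &
    forall n, (1 <= n <= j.+1)%N ->
      j.+1%:R <= phin n ((next j us).1 / j.+1%:R) * V ((next j us).2%:R / 2)].
  have /choice[f fP] (jus : nat * (R * nat)) : exists us' : R * nat, 0 < jus.2.1 ->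
      [/\ 0 < us'.1 <= jus.2.1, (jus.2.2.*2 < us'.2)%N,
      phi (jus.1.+1%:R * us'.1) * V us'.2%:R <= 2^-1 ^+ jus.1.+1 &
      forall n, (1 <= n <= jus.1.+1)%N ->
        jus.1.+1%:R <= phin n (us'.1 / jus.1.+1%:R) * V (us'.2%:R / 2)].
    have [u0|u0] := pselect (0 < jus.2.1); last by exists jus.2 => /u0.
    by have [u [N H]] := block_step jus.2.2 (ltn0Sn jus.1) u0; exists (u, N).
  by exists (fun j us => f (j, us)) => j us; exact: (fP (j, us)).
pose fix st j := if j is j'.+1 then next j (st j') else next 0%N (1, 0%N).
have st0 j : 0 < (st j).1.
  elim: j => [|j IH]; first by have [/andP[]] := nextP 0%N (1, 0%N) ltr01.
  by have [/andP[]] := nextP j.+1 (st j) IH.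
exists (fun j => (st j).1), (fun j => (st j).2); split=> //.
- by move=> j; split=> //; have [/andP[]] := nextP j.+1 (st j) (st0 j).
- by have [] := nextP 0%N (1, 0%N) ltr01.
- by move=> j; have [] := nextP j.+1 (st j) (st0 j).
- by case=> [|j]; [have [] := nextP 0%N (1, 0%N) ltr01|have [] := nextP j.+1 (st j) (st0 j)].
- by case=> [|j]; [have [] := nextP 0%N (1, 0%N) ltr01|have [] := nextP j.+1 (st j) (st0 j)].
Qed.

End blocks_choice.

(** * Functions constant on blocks *)

(** The exponent of 2 in [j + 1]; what matters is that all fibres are infinite. *)
Definition row (j : nat) : nat := logn 2 j.+1.

Lemma row_surj i m : exists2 j, (m <= j)%N & row j = i.
Proof.
exists (2 ^ i * m.*2.+1).-1.
  rewrite -ltnS prednK ?muln_gt0 ?expn_gt0//.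
  by apply: leq_trans (leq_pmull _ _); rewrite ?expn_gt0// ltnS -addnn leq_addr.
rewrite /row prednK ?muln_gt0 ?expn_gt0// lognM ?expn_gt0// pfactorK//.
by rewrite logn_coprime ?addn0// coprime2n /= odd_double.
Qed.

Section block_functions.
Variables (R : realType) (u : nat -> R) (s : nat -> nat).
Hypothesis u_gt0 : forall j, 0 < u j.
Hypothesis u_ni : forall j, u j.+1 <= u j.
Hypothesis s0_gt0 : (0 < s 0%N)%N.
Hypothesis s_double : forall j, ((s j).*2 < s j.+1)%N.

(** The least [j] with [t < s j]; as [j < s j], the search may stop beyond [t]. *)
Definition block_index (t : R) : nat :=
  find (fun j => t < (s j)%:R :> R) (iota 0 (Num.truncn t).+2).
Local Notation b := block_index.

Lemma block_end_gt j : (j < s j)%N.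
Proof.
elim: j => // j IH; apply: leq_ltn_trans (s_double j).
by rewrite -addnn (leq_trans IH)// leq_addr.
Qed.

Lemma block_index_has (t : R) : has (fun j => t < (s j)%:R :> R) (iota 0 (Num.truncn t).+2).
Proof.
apply/hasP; exists (Num.truncn t).+1; first by rewrite mem_iota/= add0n ltnS.
apply: (lt_le_trans (truncnS_gt t)); rewrite ler_nat ltnW//.
exact: block_end_gt.
Qed.

Lemma block_index_lt t : t < (s (b t))%:R.
Proof.
have := nth_find 0%N (block_index_has t); rewrite nth_iota//.
by have := block_index_has t; rewrite has_find size_iota.
Qed.

Lemma block_index_min t i : (i < b t)%N -> (s i)%:R <= t.
Proof.
move=> ib; rewrite leNgt; have := before_find 0%N ib.
have bn : (b t < (Num.truncn t).+2)%N.
  by have := block_index_has t; rewrite has_find size_iota.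
by rewrite nth_iota ?(ltn_trans ib)// add0n => ->.
Qed.

Lemma block_index_le t j : t < (s j)%:R -> (b t <= j)%N.
Proof. by move=> tj; rewrite leqNgt; apply/negP => /block_index_min; rewrite leNgt tj. Qed.

Lemma block_index_mono t t' : t <= t' -> (b t <= b t')%N.
Proof. by move=> tt'; apply/block_index_le/(le_lt_trans tt')/block_index_lt. Qed.

Lemma block_value_mono i j : (i <= j)%N -> u j <= u i.
Proof. by apply: (homo_leq (f := u) (r := fun x y => y <= x)) => // x y z xy /le_trans; apply. Qed.

Lemma measurable_block j :
  measurable ([set t | b t = j] : set (measurableTypeR R)).
Proof.
apply: is_interval_measurable => x y /= bx by_ z /andP[xz zy].
by apply/eqP; rewrite eqn_leq -{1}by_ -bx !block_index_mono.
Qed.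

Lemma measurable_block_comp (h : nat -> R) :
  measurable_fun [set: measurableTypeR R] (h \o b).
Proof.
move=> _ Y mY; rewrite setTI.
have -> : (h \o b) @^-1` Y = \bigcup_(j in h @^-1` Y) [set t | b t = j].
  by apply/seteqP; split=> [t Yt|t [j Yj /= bt]]; [exists (b t)|rewrite /= bt].
by apply: bigcup_measurable => j _; exact: measurable_block.
Qed.

(** The block [[s (j - 1), s j[] is longer than [s j / 2] because [s] more than
    doubles at each step. *)
Lemma block_measure j :
  (((s j)%:R / 2)%:E < leb_I R [set t | b t = j])%E.
Proof.
pose p := if j is j'.+1 then s j' else 0%N.
have pj : (p.*2 < s j)%N by rewrite /p; case: j {p} => //.
apply: (@lt_le_trans _ _ (lebesgue_measure (`[p%:R, (s j)%:R[%classic : set R))).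
  rewrite lebesgue_measure_itv/= lte_fin ltr_nat.
  have -> : (p < s j)%N by apply: leq_ltn_trans pj; rewrite -addnn leq_addr.
  rewrite -EFinB lte_fin.
  have : p%:R * 2 < (s j)%:R :> R by rewrite -natrM ltr_nat muln2.
  lra.
have mb : measurable ([set t | b t = j] : set (lebesgue_type R)).
  by apply: borel_lebesgue_measurable; exact: measurable_block.
apply: (@le_measure _ _ _ (leb R)).
- exact/mem_set/borel_lebesgue_measurable.
- by apply/mem_set; apply: measurableI mb _; exact: measurable_half_line.
- move=> t; rewrite /= in_itv/= => /andP[pt tj]; split=> /=.
    apply/eqP; rewrite eqn_leq block_index_le//=.
    move: pt; rewrite /p; case: j {p pj tj mb} => // j jt.
    rewrite ltnNge; apply/negP => bj; have := block_index_lt t.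
    rewrite ltNge => /negP; apply; apply: le_trans jt.
    rewrite ler_nat; move: bj; apply: (homo_leq (f := s) (r := leq)) => //.
      exact: leq_trans.
    by move=> k; apply: ltnW; apply: leq_ltn_trans (s_double k); rewrite -addnn leq_addr.
  by rewrite /half_line/= in_itv/= andbT; apply: le_trans pt.
Qed.

(** The combination with coefficients [a i] of the disjointly supported functions
    [F_i] that equal [u j] on the blocks [j] of row [i]. *)
Definition block_fun (a : nat -> R) : lebesgue_type R -> R :=
  (fun j => a (row j) * u j) \o b.

Lemma measurable_block_fun a : measurable_fun [set: lebesgue_type R] (block_fun a).
Proof.
by apply: borel_lebesgue_measurable_fun => //; exact: measurable_block_comp.
Qed.

HB.instance Definition _ a :=
  isMeasurableFun.Build _ _ _ _ (block_fun a) (measurable_block_fun a).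

Definition block_class (a : nat -> R) : L0 R := L0_class (block_fun a).


Lemma block_classE a : {ae leb_I R, forall t, block_class a t = block_fun a t}.
Proof. by apply: filterS (L0_classK (block_fun a)) => t ->. Qed.

Lemma block_class_lin k a a' :
  block_class (fun i => k * a i + a' i) = k *: block_class a + block_class a'.
Proof.
apply: L0_eqP.
apply: filter_app (block_classE (fun i => k * a i + a' i)).
apply: filter_app (block_classE a); apply: filter_app (block_classE a').
move: (L0_funD (k *: block_class a) (block_class a')) (L0_funZ k (block_class a)).
apply: filterS2 => t e1 e2 e3 e4 e5 tT.
by rewrite e5 e1// e2// e3 e4 /block_fun/= mulrDl mulrA.
Qed.

Lemma block_class0 : block_class (fun=> 0) = 0.
Proof.
apply: L0_eqP; move: (block_classE (fun=> 0)) (L0_fun0 R).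
by apply: filterS2 => t -> -> // _; rewrite /block_fun/= mul0r.
Qed.

Lemma block_class_sum (I : Type) (r : seq I) (k : I -> R) (a : I -> nat -> R) :
  \sum_(x <- r) k x *: block_class (a x) =
  block_class (fun i => \sum_(x <- r) k x * a x i).
Proof.
elim: r => [|x r IH].
  by rewrite big_nil -block_class0; congr block_class; apply/funext => i; rewrite big_nil.
rewrite big_cons IH -block_class_lin; congr block_class; apply/funext => i.
by rewrite big_cons.
Qed.

(** A block is not a null set, so that what holds a.e. holds somewhere on it. *)
Lemma block_ae j (P : lebesgue_type R -> Prop) :
  {ae leb_I R, forall t, P t} -> exists2 t, b t = j & P t.
Proof.
move=> aeP; apply: contrapT => nP.
have := block_measure j; rewrite ltNge => /negP; apply.
apply: (@le_trans _ _ (leb_I R set0)); last by rewrite measure0 lee_fin divr_ge0.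
apply: ae_le_measure => //.
  by apply: borel_lebesgue_measurable; exact: measurable_block.
by apply: filterS aeP => t Pt bt; apply: nP; exists t.
Qed.

Lemma block_class_inj a : block_class a = 0 -> forall i, a i = 0.
Proof.
move=> a0 i; have [j _ ji] := row_surj i 0.
have aefa : {ae leb_I R, forall t, block_fun a t = 0}.
  move: (block_classE a) (L0_fun0 R); rewrite a0.
  by apply: filterS2 => t <- ->.
have [t bt] := block_ae j aefa.
by rewrite /block_fun/= bt ji => /eqP; rewrite mulf_eq0 (gt_eqF (u_gt0 j)) orbF => /eqP.
Qed.



Variables (w phi : R -> R) (phin : nat -> R -> R).
Hypotheses (w_weight : weight_function w) (phi_orlicz : orlicz_function phi).
Hypothesis phin_orlicz : forall n, (1 <= n)%N -> orlicz_function (phin n).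
Local Notation lambda := (@lebesgue_measure R).
Local Notation W := (weight_primitive w).
Hypothesis phi_small : forall j,
  phi (j.+1%:R * u j) * fine (W (s j)%:R) <= 2^-1 ^+ j.+1.
Hypothesis phin_large : forall j n, (1 <= n <= j.+1)%N ->
  j.+1%:R <= phin n (u j / j.+1%:R) * fine (W ((s j)%:R / 2)).

Lemma weight_primitive_fineK x : 0 < x -> (fine (W x))%:E = W x.
Proof.
move=> x0; rewrite fineK// ge0_fin_numE ?weight_primitive_lty//.
exact/ltW/weight_primitive_gt0.
Qed.

Lemma block_end_gt0 j : 0 < (s j)%:R :> R.
Proof. by rewrite ltr0n (leq_ltn_trans _ (block_end_gt j)). Qed.

(** From [j + 1 >= k] on, [phi (k * u j) <= phi ((j + 1) * u j)], and finitely many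
    indices remain. *)
Lemma phi_block_bound k : 0 < k -> exists2 C, 0 <= C &
  forall j, phi (k * u j) * fine (W (s j)%:R) <= C / (2 ^ j.+1)%:R.
Proof.
move=> k0; pose T j := phi (k * u j) * fine (W (s j)%:R).
have T0 j : 0 <= T j.
  apply: mulr_ge0; first by apply: orlicz_ge0 => //; rewrite mulr_ge0 ?ltW.
  by apply/fine_ge0/ltW/weight_primitive_gt0/block_end_gt0.
have p2 j : 0 < (2 ^ j)%:R :> R by rewrite ltr0n expn_gt0.
pose N := (Num.truncn k).+1; pose C := 1 + \sum_(j < N) T j * (2 ^ j.+1)%:R.
have C1 : 1 <= C by rewrite lerDl sumr_ge0// => j _; rewrite mulr_ge0// ltW.
exists C; first by rewrite (le_trans _ C1).
move=> j; rewrite ler_pdivlMr//; have [jN|Nj] := ltnP j N.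
  rewrite /C (bigD1 (Ordinal jN))//= addrA addrAC lerDr.
  by rewrite addr_ge0// sumr_ge0// => i _; rewrite mulr_ge0// ltW.
apply: (le_trans _ C1); rewrite -ler_pdivlMr// mul1r natrX -exprVn.
apply: le_trans (phi_small j); rewrite ler_wpM2r//.
  exact/fine_ge0/ltW/weight_primitive_gt0/block_end_gt0.
apply: orlicz_le => //; first by rewrite mulr_ge0 ?ltW.
rewrite ler_pM2r//; apply: (le_trans (ltW (truncnS_gt k))).
by rewrite ler_nat ltnW.
Qed.

(** On the [j]-th block the integrand contributes at most
    [phi (k * u j) * W (s j)], and these bounds have a finite sum. *)
Lemma modular_heart_block a : (forall i, `|a i| <= 1) ->
  modular_heart w phi (block_class a).
Proof.
move=> a1 k k0; have [C C0 HC] := phi_block_bound k0.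
apply: (@le_lt_trans _ _ C%:E); last exact: ltry.
apply: (le_trans (modular_le_integral w_weight phi_orlicz (F := fun t => k * u (b t)) _ _ _)).
- by move=> t _; rewrite mulr_gt0.
- move=> x y _ xy; rewrite ler_pM2l//; apply: block_value_mono.
  exact: block_index_mono.
- move: (ae_normZ k (block_class a)) (block_classE a).
  apply: filterS2 => t -> -> _; rewrite (gtr0_norm k0) ler_pM2l// /block_fun/=.
  by rewrite normrM (gtr0_norm (u_gt0 _)) ler_piMl// ltW.
pose D j : set (measurableTypeR R) := `]0, +oo[%classic `&` [set t | b t = j].
have mD j : measurable (D j) by apply: measurableI => //; exact: measurable_block.
have DE : `]0, +oo[%classic = \bigcup_j D j.
  by apply/seteqP; split=> [t t0|t [j _ []]] //; exists (b t).
have mphi : measurable_fun (`]0, +oo[%classic : set (measurableTypeR R))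
    (fun t => (phi (k * u (b t)))%:E * (w t)%:E)%E.
  apply: emeasurable_funM; last exact: measurable_weight.
  apply/measurable_EFinP; apply: measurable_funTS.
  exact: (measurable_block_comp (fun j => phi (k * u j))).
have phi0 j : 0 <= phi (k * u j) by apply: orlicz_ge0 => //; rewrite mulr_ge0 ?ltW.
rewrite DE ge0_integral_bigcup//; last 3 first.
- by rewrite -DE.
- move=> t [j _ [/=]]; rewrite in_itv/= andbT => t0 _.
  by rewrite mule_ge0 ?lee_fin// ltW// weight_gt0.
- by apply/trivIsetP => i j _ _ ij; apply/seteqP; split=> // t [[_ /= ti] [_ /= tj]]; move: ij; rewrite -ti tj eqxx.
apply: (@le_trans _ _ (\sum_(j <oo) (C / (2 ^ j.+1)%:R)%:E)%E); last first.
  exact: epsilon_trick0.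
apply: lee_nneseries => [j _ _|j _].
  apply: integral_ge0 => t [/=]; rewrite in_itv/= andbT => t0 _.
  by rewrite mule_ge0 ?lee_fin// ltW// weight_gt0.
apply: (@le_trans _ _ ((phi (k * u j))%:E * W (s j)%:R)%E); last first.
  by rewrite -weight_primitive_fineK ?block_end_gt0// -EFinM lee_fin.
have mw : measurable_fun (`]0, (s j)%:R]%classic : set (measurableTypeR R)) (EFin \o w).
  by apply: measurable_weight => //; exact: subset_itv0_pos.
rewrite /weight_primitive -ge0_integralZl//; last 2 first.
- by move=> t; rewrite /= in_itv/= lee_fin => /andP[t0 _]; rewrite ltW// weight_gt0.
- by rewrite lee_fin.
have -> : (\int[lambda]_(t in D j) ((phi (k * u (b t)))%:E * (w t)%:E) =
    \int[lambda]_(t in D j) ((phi (k * u j))%:E * (EFin \o w) t))%E.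
  by apply: eq_integral => t; rewrite inE => -[_ /= ->].
apply: ge0_subset_integral => //.
- by apply: emeasurable_funM.
- move=> t; rewrite /= in_itv/= => /andP[t0 _].
  by rewrite mule_ge0 ?lee_fin// ltW// weight_gt0.
- move=> t [/=]; rewrite !in_itv/= andbT => -> /= <-.
  exact/ltW/block_index_lt.
Qed.

(** Let [j] run through the row [i]. Once [(j + 1) * k * |a i| > 1], the function
    [k *: block_class a] exceeds [u j / (j + 1)] on a block of measure more than
    [s j / 2], which forces its modular above [j + 1]. *)
Lemma block_class_notin a i n : a i != 0 -> (1 <= n)%N ->
  ~ orlicz_lorentz (phin n) w (block_class a).
Proof.
move=> ai0 n1 [k k0 rhoy]; have phin_o := phin_orlicz n1.
set rho := modular _ _ _ in rhoy.
have rho_fin : rho \is a fin_num by rewrite ge0_fin_numE// modular_ge0.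
have ka0 : 0 < k * `|a i| by rewrite mulr_gt0// normr_gt0.
pose m := maxn n (maxn (Num.truncn (k * `|a i|)^-1).+1 (Num.truncn (fine rho)).+1).
have [j mj ji] := row_surj i m.
have nj : (n <= j.+1)%N by rewrite (leq_trans _ (leqW mj))// leq_max leqnn.
have kj : (k * `|a i|)^-1 < j.+1%:R.
  apply: (lt_le_trans (truncnS_gt _)); rewrite ler_nat (leq_trans _ (leqW mj))//.
  by rewrite /m !leq_max leqnn orbT.
have rj : fine rho < j.+1%:R.
  apply: (lt_le_trans (truncnS_gt _)); rewrite ler_nat (leq_trans _ (leqW mj))//.
  by rewrite /m !leq_max leqnn !orbT.
have j0 : 0 < j.+1%:R :> R by rewrite ltr0n.
pose l := u j / j.+1%:R; have l0 : 0 < l by rewrite divr_gt0.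
have dl : (((s j)%:R / 2)%:E < distribution_function (k *: block_class a) l)%E.
  apply: (lt_le_trans (block_measure j)); apply: ae_le_measure.
  - by apply: borel_lebesgue_measurable; exact: measurable_block.
  - exact: measurable_L0_norm_gt.
  move: (ae_normZ k (block_class a)) (block_classE a).
  apply: filterS2 => t /= -> -> /= bt; rewrite /block_fun/= bt ji.
  rewrite normrM (gtr0_norm k0) (gtr0_norm (u_gt0 j)) mulrA /l mulrC ltr_pM2r//.
  by rewrite -[X in _ < X]invrK ltf_pV2// ?posrE ?invr_gt0.
have := modular_ge w_weight phin_o l0 dl; rewrite leNgt => /negP; apply.
rewrite -/rho -weight_primitive_fineK ?divr_gt0 ?block_end_gt0//.
rewrite -(fineK rho_fin) -EFinM lte_fin; apply: (lt_le_trans rj).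
by apply: phin_large; rewrite n1.
Qed.

(** A norm limit of block functions is an a.e. limit of some of them, by the
    Borel-Cantelli lemma, and then their coefficients converge as well. *)
Lemma block_class_closed (x : L0 R) :
  (forall e : R, 0 < e -> exists a, (luxemburg phi w (x - block_class a)%R < e%:E)%E) ->
  exists a, x = block_class a.
Proof.
move=> xcl; pose q m : R := 1 / (2 ^ m.+1)%:R.
have q0 m : 0 < q m by rewrite divr_gt0// ltr0n expn_gt0.
have /choice[a aP] m : exists a, (distribution_function (x - block_class a)%R (q m) <= (q m)%:E)%E.
  have [e e0 eP] := luxemburg_small w_weight phi_orlicz (q0 m) (q0 m).
  by have [a /eP] := xcl e e0; exists a.
pose F m : set (lebesgue_type R) := [set t | q m < `|(x - block_class (a m) : L0 R) t|].
have mF m : measurable (F m) by exact: measurable_L0_norm_gt.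
have F0 : leb_I R (lim_sup_set F) = 0%E.
  apply: lim_sup_set_cvg0 => //.
  apply: (@le_lt_trans _ _ 1%:E); last exact: ltry.
  apply: le_trans (epsilon_trick0 xpredT ler01).
  by apply: lee_nneseries => [m _ _|m _]; [exact: measure_ge0|exact: aP].
have aeF : {ae leb_I R, forall t, exists n, forall m, (n <= m)%N ->
    `|(x - block_class (a m) : L0 R) t| <= q m}.
  exists (lim_sup_set F); split=> //.
    by apply: bigcapT_measurable => n; apply: bigcup_measurable.
  move=> t /= /forallNP nt n _; apply: contrapT => nF; apply: (nt n) => m nm.
  by rewrite leNgt; apply/negP => qm; apply: nF; exists m.
have qcvg : q @ \oo --> (0 : R).
  have -> : q = fun m => 2^-1 * 2^-1 ^+ m.
    by apply/funext => m; rewrite /q natrX div1r exprS invfM exprVn.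
  rewrite -[X in _ --> X](mulr0 2^-1); apply: cvgMr; apply: cvg_expr.
  by rewrite ger0_norm ?invr_ge0// invf_lt1// ltr1n.
exists (fun i => lim ((fun m => a m i) @ \oo)); apply: L0_eqP.
have aeE : {ae leb_I R, forall t, forall m, (x - block_class (a m) : L0 R) t =
    x t - block_fun (a m) t}.
  apply: ae_foralln => m; apply: filter_app (block_classE (a m)).
  move: (L0_funD x (- block_class (a m))) (L0_funN (block_class (a m))).
  by apply: filterS2 => t e1 e2 e3; rewrite e1// e2// e3.
move: (block_classE (fun i => lim ((fun m => a m i) @ \oo))) aeF aeE.
apply: filterS3 => t -> [n xn] xE _; rewrite /block_fun/=.
have acvg : (fun m => a m (row (b t))) @ \oo --> x t / u (b t).
  have -> : (fun m => a m (row (b t))) =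
      fun m => (x t - (x - block_class (a m) : L0 R) t) / u (b t).
    by apply/funext => m; rewrite xE opprB addrC subrK /block_fun/= mulfK// gt_eqF.
  apply: cvgMl; rewrite -[X in _ --> X]subr0; apply: cvgB; first exact: cvg_cst.
  apply/cvgrPdist_le => e e0; near=> m; rewrite sub0r normrN.
  apply: (@le_trans _ _ (q m)); first by apply: xn; near: m; exact: nbhs_infty_ge.
  have : `|0 - q m| <= e by near: m; move/cvgrPdist_le : qcvg; apply.
  by rewrite sub0r normrN gtr0_norm.
by rewrite (cvg_lim _ acvg)// divfK// gt_eqF.
Unshelve. all: by end_near. Qed.

End block_functions.

(** * Spaceability *)

Section geometric_blocks.
Variables (R : realType) (u : nat -> R) (s : nat -> nat).
Hypothesis u_gt0 : forall j, 0 < u j.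
Hypothesis s0_gt0 : (0 < s 0%N)%N.
Hypothesis s_double : forall j, ((s j).*2 < s j.+1)%N.
Local Notation block := (block_class u s0_gt0 s_double).

(** Any injection of the reals into the unit interval would do. *)
Definition ratio (x : R) : R := (1 + expR x)^-1.

Lemma ratio_inj : injective ratio.
Proof. by move=> x y /invr_inj/addrI/expR_inj. Qed.

Lemma norm_ratioX_le1 x i : `|ratio x ^+ i| <= 1.
Proof.
have x0 := expR_gt0 x; have r1 : 1 <= 1 + expR x by lra.
rewrite normrX exprn_ile1// /ratio ger0_norm ?invr_ge0 ?invf_le1//; lra.
Qed.

Definition geometric_block (x : R) : L0 R := block (fun i => ratio x ^+ i).

Lemma geometric_block_inj : injective geometric_block.
Proof.
move=> x y xy; apply: ratio_inj; apply/eqP; rewrite -subr_eq0 -oppr_eq0 opprB.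
have /(block_class_inj u_gt0)/(_ 1%N) :
    block (fun i => -1 * ratio x ^+ i + ratio y ^+ i) = 0.
  by rewrite block_class_lin -/(geometric_block x) xy scaleN1r addNr.
by rewrite !expr1 mulN1r addrC => ->.
Qed.

(** A relation between finitely many of them is, row by row, a relation between
    the powers of their ratios. *)
Lemma geometric_block_independent : linearly_independent (range geometric_block).
Proof.
move=> r c ur rg r0.
have /choice[h hP] v : exists t, v \in r -> v = block (fun i => t ^+ i).
  have [/rg[x _ <-]|_] := boolP (v \in r); last by exists 0.
  by exists (ratio x).
have hinj : {in r &, injective h}.
  by move=> v v' vr v'r hv; rewrite (hP v vr) (hP v' v'r) hv.
have sum0 i : \sum_(v <- r) c v * h v ^+ i = 0.
  apply: (block_class_inj u_gt0 (s0_gt0 := s0_gt0) (s_double := s_double)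
    (a := fun i => \sum_(v <- r) c v * h v ^+ i)).
  rewrite -block_class_sum -[RHS]r0 [LHS]big_seq [RHS]big_seq.
  by apply: eq_bigr => v vr; rewrite -hP.
move=> v vr; rewrite {1}(hP v vr).
apply: (@power_sums_eq0 _ (map h r) (fun t => c (block (fun i => t ^+ i)))).
- by rewrite map_inj_in_uniq.
- move=> i; rewrite big_map -[RHS](sum0 i) [LHS]big_seq [RHS]big_seq.
  by apply: eq_bigr => v' v'r; rewrite -hP.
- exact: map_f.
Qed.

End geometric_blocks.

Theorem theorem4p4 (R : realType) (w phi : R -> R) (phin : nat -> R -> R)
    (w_weight : weight_function w)
    (phi_orlicz : orlicz_function phi)
    (phin_orlicz : forall n, (1 <= n)%N -> orlicz_function (phin n))
    (phin_Delta : forall n, (1 <= n)%N -> Delta_zero phi (phin n)) :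
  continuum_spaceable (order_continuous_part phi w) (luxemburg phi w)
    (order_continuous_part phi w `\`
       \bigcup_(n in [set n | (1 <= n)%N]) orlicz_lorentz (phin n) w) /\
  (Delta2 phi ->
   maximal_spaceable (orlicz_lorentz phi w) (luxemburg phi w)
     (orlicz_lorentz phi w `\`
        \bigcup_(n in [set n | (1 <= n)%N]) orlicz_lorentz (phin n) w)).
Proof.
have Wfin x : weight_primitive w x \is a fin_num.
  rewrite ge0_fin_numE ?weight_primitive_lty// integral_ge0// => t.
  by rewrite /= in_itv/= => /andP[t0 _]; exact: weight_ge0.
have [u [s [u_P s0_gt0 s_double phi_small phin_large]]] :
    exists (u : nat -> R) (s : nat -> nat),
    [/\ forall j, 0 < u j /\ u j.+1 <= u j, (0 < s 0%N)%N,
      forall j, ((s j).*2 < s j.+1)%N,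
      forall j, phi (j.+1%:R * u j) * fine (weight_primitive w (s j)%:R) <= 2^-1 ^+ j.+1 &
      forall j n, (1 <= n <= j.+1)%N ->
        j.+1%:R <= phin n (u j / j.+1%:R) * fine (weight_primitive w ((s j)%:R / 2))].
  apply: (@blocks_exist _ phi phin (fun x => fine (weight_primitive w x))) => //.
  - by move=> x y xy; apply: fine_le => //; exact: weight_primitive_le.
  - move=> x; rewrite -lee_fin EFinM !fineK//; exact: weight_primitive_double.
  - move=> x; apply: fine_ge0; apply: integral_ge0 => t.
    by rewrite /= in_itv/= => /andP[t0 _]; exact: weight_ge0.
  - move=> A; have [n An] := weight_primitive_unbounded w_weight A.
    by exists n; rewrite -lte_fin fineK.
have u_gt0 j : 0 < u j by have [] := u_P j.
have u_ni j : u j.+1 <= u j by have [] := u_P j.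
pose block := block_class u s0_gt0 s_double.
(* This one subspace answers both halves: it is closed in the whole space, and
   so in its order continuous part. *)
pose M := modular_heart w phi `&` range block.
have Mlin : linear_subspace M.
  have [h0 hlin] := linear_modular_heart w_weight phi_orlicz.
  split; first by split=> //; exists (fun=> 0) => //; exact: block_class0.
  move=> k x y [hx [a _ ax]] [hy [a' _ ay]]; split; first exact: hlin.
  by exists (fun i => k * a i + a' i) => //; rewrite /block block_class_lin -ax -ay.
have Moc : M `<=` order_continuous_part phi w.
  by move=> x [hx _]; exact: modular_heart_order_continuous.
have MLambda : M `<=` orlicz_lorentz phi w by move=> x /Moc[].
have Mcl X : closed_in X (luxemburg phi w) M.
  move=> x _ xcl; split.
    apply: modular_heart_closed => // e /xcl[y [hy _] xy]; by exists y.
  have [e e0|a ->] := block_class_closed u_gt0 (s0_gt0 := s0_gt0)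
      (s_double := s_double) w_weight phi_orlicz (x := x); last by exists a.
  by have [_ [_ [a _ <-]] xy] := xcl e e0; exists a.
have Mout X : M `<=` X ->
    M `<=` X `\` \bigcup_(n in [set n | (1 <= n)%N]) orlicz_lorentz (phin n) w `|` [set 0].
  move=> MX x Mx; have [x0|x0] := pselect (x = 0); [by right|left].
  split; first exact: MX.
  move=> [n /= n1 xn]; case: Mx => _ [a _ ax]; apply: x0.
  have [a0|/existsNP[i /eqP ai0]] := pselect (forall i, a i = 0).
    rewrite -ax -(block_class0 u s0_gt0 s_double); congr block_class.
    exact/funext.
  by rewrite -ax in xn; case: (block_class_notin u_gt0 w_weight phin_orlicz phin_large ai0 n1 xn).
have gM : range (geometric_block u s0_gt0 s_double) `<=` M.
  move=> _ [x _ <-]; split; last by exists (fun i => ratio x ^+ i).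
  by apply: modular_heart_block => // i; exact: norm_ratioX_le1.
have dim_continuum X : linear_subspace X -> M `<=` X ->
    exists2 B, algebraic_basis X B & (B #= [set: R])%card.
  move=> Xlin MX; apply: (continuum_basis (e := geometric_block u s0_gt0 s_double)) => //.
  - exact: card_L0_le.
  - exact: geometric_block_inj.
  - exact: subset_trans gM MX.
  - exact: geometric_block_independent.
have [B Bbasis Bcard] := dim_continuum M Mlin (@subset_refl _ _).
split=> [|_].
  by exists M; split=> //; [exists B|exact: Mout].
have Llin := linear_orlicz_lorentz w_weight phi_orlicz.
have [C Cbasis Ccard] := dim_continuum _ Llin MLambda.
exists C => //; exists M; split=> //; last exact: Mout.
by exists B => //; apply: card_eq_trans Bcard _; rewrite card_eq_sym.
Qed.
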